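(* Let $d,k$ be positive integers with $dk=n-1$, and let $\omega_d$ be any primitive complex $d$-th root of unity. Then \[ A_{(n)}^{{\rm maj},{\rm exc}}(\omega_d,t\omega_d^{-1})=t\,A_k(t)\,[d]_t^k. \]
   Context: Permutations act on the right. For $\sigma\in S_m$: ${\rm exc}(\sigma)=|\{i\in[m-1]:i\sigma>i\}|$, ${\rm maj}(\sigma)=\sum\{i\in[m-1]:i\sigma>(i+1)\sigma\}$. $A_{(n)}^{{\rm maj},{\rm exc}}(q,t)=\sum_{\sigma}q^{{\rm maj}(\sigma)}t^{{\rm exc}(\sigma)}$, summed over all $n$-cycles $\sigma\in S_n$. $A_k(t)=\sum_{\sigma\in S_k}t^{{\rm exc}(\sigma)}$, $[d]_t=1+t+\cdots+t^{d-1}$. *)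

(* Defs.v *)
From HB Require Import structures.
From mathcomp Require Import all_boot all_order all_algebra all_fingroup.

Set Implicit Arguments.
Unset Strict Implicit.
Unset Printing Implicit Defensive.

Import GRing.Theory.
Local Open Scope ring_scope.

(* The letter i of [m] = {1, ..., m} is the ordinal i - 1 of 'I_m.  In 'S_m the
   product acts on the right, (s * t) x = t (s x), so "i sigma" is s i. *)

Definition exc (m : nat) (s : 'S_m) : nat :=
  #|[set i : 'I_m | (i.+1 < m)%N && (i < s i)%N]|.

(* A descent at the ordinal i contributes its 1-based position i.+1; under the
   guard i.+1 < m, ordS i has value i.+1. *)
Definition maj (m : nat) (s : 'S_m) : nat :=
  (\sum_(i < m | (i.+1 < m) && (s (ordS i) < s i)) i.+1)%N.

(* porbits s is the set of supports of all cycles of s, fixed points included. *)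
Definition is_ncycle (n : nat) (s : 'S_n) : bool :=
  porbits s == [set [set: 'I_n]].

(* The polynomials below are given by their values at elements of an arbitrary
   commutative ring; an indeterminate t is 'X in a polynomial ring. *)

Definition Acyc_maj_exc (R : comNzRingType) (n : nat) (q t : R) : R :=
  \sum_(s : 'S_n | is_ncycle s) q ^+ maj s * t ^+ exc s.

Definition eulerian (R : comNzRingType) (k : nat) (t : R) : R :=
  \sum_(s : 'S_k) t ^+ exc s.

Definition qint (R : comNzRingType) (d : nat) (t : R) : R :=
  \sum_(i < d) t ^+ i.

(* Main.v *)
Require Import Defs.
From HB Require Import structures.
From mathcomp Require Import all_boot all_order all_algebra all_fingroup.
From mathcomp Require Import ring zify.
From mathcomp Require Import reals complex.

(** Write q for the variable of the outer polynomial ring and put t in the base ring.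
    Since maj = exd + exc, where exd is the sum of the set Exd of Shareshian and Wachs, the
    left-hand side is the value at q = w of P_n(q) = \sum q^exd t^exc over the n-cycles.

    Words.  A weakly decreasing labelling of the positions by letters, strict at Exd(s), has
    generating function q^exd(s) / (q; q)_n.  Reading the labels along the cycle s, with a bar
    on the excedances, is a bijection onto primitive circular words in which a letter is
    followed by a weakly smaller one when barred and by a weakly larger one otherwise; the
    inverse ranks the rotations of the word lexicographically.  Hence, up to non-primitive
    words, n P_n(q) / (q; q)_n is the weighted number W_n of all such words.  The non-primitive
    words of length n = dk + 1 contribute multiples of (q; q)_n / (q^e; q^e)_m with em = n and
    e > 1, which vanish at w.

    Evaluation.  W_n is the trace of the n-th power of a transfer matrix whose reversed
    characteristic polynomial is (E(z) - t E(tz)) / (1 - t), with E(z) = \prod_i (1 - q^i z).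
    Newton's identities, multiplied by (q; q)_n and taken at q = w, become a recurrence whose
    coefficients are those of \prod_(i < n) (1 - w^i z), that is of (1 - z^d)^k (1 - z) for
    n = dk + 1.  It is solved by means of the binomial identity
    \sum_i C(k, i) (t - 1)^i A_(k-i) = t A_k (k > 0) of the Eulerian polynomials.

    Power series in q are replaced by polynomials modulo q^M, the letters being those below M. *)

Set Implicit Arguments.
Unset Strict Implicit.
Unset Printing Implicit Defensive.

Import GRing.Theory.
Local Open Scope ring_scope.

(** * Polynomials in q modulo a power of q *)

Section Truncation.
Variable A : comNzRingType.
Implicit Types p r : {poly A}.

Definition eqm (M : nat) p r := forall i, (i < M)%N -> p`_i = r`_i.

Lemma eqm_sym M p r : eqm M p r -> eqm M r p.
Proof. by move=> h i hi; rewrite h. Qed.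

Lemma eqm_trans M p r (s : {poly A}) : eqm M p r -> eqm M r s -> eqm M p s.
Proof. by move=> h1 h2 i hi; rewrite h1 // h2. Qed.

Lemma eqmD M p r p' r' : eqm M p r -> eqm M p' r' -> eqm M (p + p') (r + r').
Proof. by move=> h1 h2 i hi; rewrite !coefD h1 // h2. Qed.

Lemma eqmN M p r : eqm M p r -> eqm M (- p) (- r).
Proof. by move=> h i hi; rewrite !coefN h. Qed.

Lemma eqmM M p r p' r' : eqm M p r -> eqm M p' r' -> eqm M (p * p') (r * r').
Proof.
move=> h1 h2 i hi; rewrite !coefM; apply: eq_bigr => j _.
by rewrite h1 ?h2 //; [apply: leq_ltn_trans hi; exact: leq_subr
  | apply: leq_trans hi; exact: ltn_ord].
Qed.

Lemma eqmMl M (s p r : {poly A}) : eqm M p r -> eqm M (s * p) (s * r).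
Proof. exact: eqmM. Qed.

Lemma eqm_sum M (I : Type) (l : seq I) (P : pred I) (F G : I -> {poly A}) :
  (forall i, P i -> eqm M (F i) (G i)) ->
  eqm M (\sum_(i <- l | P i) F i) (\sum_(i <- l | P i) G i).
Proof.
by move=> h; elim/big_ind2: _ => // *; apply: eqmD.
Qed.

Lemma eqm_Xn0 M k : (M <= k)%N -> eqm M 'X^k 0.
Proof. by move=> hk i hi; rewrite coefXn coef0; case: eqP => // ?; lia. Qed.

(** A constant term 1 makes s a unit among power series; comparing coefficients in increasing degree
    avoids its inverse. *)
Lemma eqm_cancel M (s p r : {poly A}) : s`_0 = 1 -> eqm M (s * p) (s * r) -> eqm M p r.
Proof.
move=> s0 h i; elim/ltn_ind: i => i IH hi.
have := h i hi; rewrite !coefM !big_ord_recl /= s0 !subn0 !mul1r.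
rewrite (_ : \sum_(j < i) s`_(bump 0 j) * p`_(i - bump 0 j) =
  \sum_(j < i) s`_(bump 0 j) * r`_(i - bump 0 j)); first exact: addIr.
apply: eq_bigr => j _; rewrite IH //; have := ltn_ord j; rewrite /bump; lia.
Qed.

Lemma eqm_eq p r : (forall M, eqm M.+1 p r) -> p = r.
Proof. by move=> h; apply/polyP => i; apply: (h i). Qed.

(* (q^e; q^e)_n *)
Definition qpoch (e n : nat) : {poly A} := \prod_(i < n) (1 - 'X^(e * i.+1)).

Lemma qpochS e n : qpoch e n.+1 = qpoch e n * (1 - 'X^(e * n.+1)).
Proof. by rewrite /qpoch big_ord_recr. Qed.

Lemma coef0_prod_1 (I : Type) (l : seq I) (P : pred I) (F : I -> {poly A}) :
  (forall i, P i -> (F i)`_0 = 1) -> (\prod_(i <- l | P i) F i)`_0 = 1.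
Proof.
move=> h; elim/big_ind: _ => //; first by rewrite coef1.
by move=> x y hx hy; rewrite coefM big_ord1 /= hx hy mul1r.
Qed.

(** The factors 1 - q^i of (q; q)_(em) are sorted by whether e divides i; here [e.+1] stands for
    e. *)
Lemma qpoch_mul e m :
  qpoch 1 (e.+1 * m) =
  qpoch e.+1 m * \prod_(l < m) \prod_(j < e) (1 - 'X^(e.+1 * l + j.+1)).
Proof.
elim: m => [|m IH]; first by rewrite muln0 /qpoch !big_ord0 mulr1.
rewrite qpochS big_ord_recr /= mulnS addnC /qpoch big_split_ord /=.
rewrite -[\prod_(i < e.+1 * m) _]/(qpoch 1 (e.+1 * m)) IH big_ord_recr /=.
rewrite mul1n (_ : (e.+1 * m + e).+1 = e.+1 * m.+1)%N; last lia.
under [X in _ * (X * _) = _]eq_bigr => j _ do rewrite mul1n -addnS.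
by rewrite -[\prod_(i < m) (1 - 'X^(e.+1 * i.+1))]/(qpoch e.+1 m) -mulnSr; ring.
Qed.

End Truncation.

(** * Words extended by a last letter *)

Definition snoc (T : Type) (n : nat) (s : {ffun 'I_n -> T}) (a : T) :
    {ffun 'I_n.+1 -> T} :=
  [ffun i => if unlift ord_max i is Some j then s j else a].

Lemma snoc_max T n (s : {ffun 'I_n -> T}) a : snoc s a ord_max = a.
Proof. by rewrite ffunE unlift_none. Qed.

Lemma snoc_widen T n (s : {ffun 'I_n -> T}) a (i : 'I_n) :
  snoc s a (widen_ord (leqnSn n) i) = s i.
Proof.
rewrite ffunE (_ : widen_ord _ i = lift ord_max i) ?liftK //.
by apply: val_inj; rewrite [RHS]lift_max.
Qed.

Lemma sum_snoc (V : nmodType) (T : finType) n (F : {ffun 'I_n.+1 -> T} -> V) :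
  \sum_s F s = \sum_(a : T) \sum_(s : {ffun 'I_n -> T}) F (snoc s a).
Proof.
rewrite pair_bigA /= (reindex (fun p : T * {ffun 'I_n -> T} => snoc p.2 p.1)) //.
exists (fun s : {ffun 'I_n.+1 -> T} => (s ord_max, [ffun i => s (widen_ord (leqnSn n) i)])).
  move=> [a s] _ /=; rewrite snoc_max; congr (_, _).
  by apply/ffunP => i; rewrite ffunE snoc_widen.
move=> s _ /=; apply/ffunP => i.
case: (unliftP ord_max i) => [j|] -> ; last by rewrite snoc_max.
rewrite (_ : lift ord_max j = widen_ord (leqnSn n) j) ?snoc_widen ?ffunE //.
by apply: val_inj; rewrite [LHS]lift_max.
Qed.

(* The letter after position x, the sentinel c standing at the right end. *)
Definition nxt (T : Type) (n : nat) (s : {ffun 'I_n -> T}) (c : T) (x : 'I_n) : T :=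
  if (x.+1 < n)%N then s (ordS x) else c.

Lemma nxt_snoc_max T n (s : {ffun 'I_n -> T}) a c : nxt (snoc s a) c ord_max = c.
Proof. by rewrite /nxt /= ltnn. Qed.

Lemma nxt_snoc_widen T n (s : {ffun 'I_n -> T}) a c (i : 'I_n) :
  nxt (snoc s a) c (widen_ord (leqnSn n) i) = nxt s a i.
Proof.
rewrite /nxt /= ltnS ltn_ord.
case: ltnP => hi.
  rewrite (_ : ordS _ = widen_ord (leqnSn n) (ordS i)) ?snoc_widen //.
  by apply: val_inj => /=; rewrite !modn_small // ltnS ltnW.
rewrite (_ : ordS _ = ord_max) ?snoc_max //.
have e : i.+1 = n by apply/eqP; rewrite eqn_leq hi ltn_ord.
by apply: val_inj => /=; rewrite e modn_small.
Qed.

(* The least label allowed at x when labels decrease weakly, strictly at the positions in D,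
   and the last one is at least lo. *)
Definition low (M n : nat) (D : nat -> bool) (lo : nat)
    (s : {ffun 'I_n -> 'I_M}) (x : 'I_n) : nat :=
  if (x.+1 < n)%N then (s (ordS x) + D x)%N else lo.

Lemma low_snoc_max M n D lo (s : {ffun 'I_n -> 'I_M}) a :
  low D lo (snoc s a) ord_max = lo.
Proof. by rewrite /low /= ltnn. Qed.

Lemma low_snoc_widen M n D lo (s : {ffun 'I_n -> 'I_M}) a (i : 'I_n) :
  low D lo (snoc s a) (widen_ord (leqnSn n) i) = low D (a + D n.-1)%N s i.
Proof.
have := nxt_snoc_widen s a a i; rewrite /nxt /low /= ltnS ltn_ord => ->.
case: ltnP => hi //.
by have -> : i = n.-1 :> nat by have := ltn_ord i; lia.
Qed.

(** * Labellings with prescribed strict descents *)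

Section DescentSequences.
Variable A : comNzRingType.

(** An inadmissible labelling gets a zero factor instead of being filtered out, so that the product
    splits letter by letter. *)
Definition ppart (e M n : nat) (D : nat -> bool) (lo : nat) : {poly A} :=
  \sum_(s : {ffun 'I_n -> 'I_M})
    \prod_(x < n) (if (low D lo s x <= s x)%N then 'X^(e * s x) else 0).

Lemma ppartS e M n D lo : ppart e M n.+1 D lo =
  \sum_(a < M) (if (lo <= a)%N then 'X^(e * a) else 0) * ppart e M n D (a + D n.-1)%N.
Proof.
rewrite /ppart sum_snoc; apply: eq_bigr => a _; rewrite big_distrr /=.
apply: eq_bigr => s _; rewrite big_ord_recr /= mulrC low_snoc_max snoc_max.
by congr (_ * _); apply: eq_bigr => i _; rewrite low_snoc_widen snoc_widen.
Qed.

Lemma eqm_geometric M k lo : (0 < k)%N ->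
  eqm M ((1 - 'X^k) * \sum_(a < M) (if (lo <= a)%N then 'X^(k * a) else 0))
    ('X^(k * lo) : {poly A}).
Proof.
move=> hk; have [hlo|hlo] := leqP lo M; last first.
  rewrite big1 ?mulr0; last by move=> a _; rewrite ifF //; have := ltn_ord a; lia.
  by apply/eqm_sym/eqm_Xn0; nia.
(* The sum telescopes; the second term has degree at least M. *)
have -> : (1 - 'X^k) * \sum_(a < M) (if (lo <= a)%N then 'X^(k * a) else 0) =
   'X^(k * lo) - 'X^(k * M) :> {poly A}.
  elim: M hlo => [|M IH] hlo.
    by rewrite big_ord0 mulr0 (_ : lo = 0%N) ?subrr //; lia.
  rewrite big_ord_recr /= mulrDr; move: hlo; rewrite leq_eqVlt => /orP[/eqP->|hlo].
    rewrite ltnn big1 ?mulr0 ?addr0 ?subrr //.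
    by move=> a _; rewrite ifF //; have := ltn_ord a; lia.
  rewrite IH // ifT // mulnS exprD; ring.
rewrite -[X in eqm _ _ X]subr0; apply: eqmD => //; apply: eqmN; apply: eqm_Xn0; nia.
Qed.

(** The bound [lo] raises all n labels, and a strict descent at x raises the [x.+1] labels up to x.
    What remains is a partition with at most n parts, counted by 1 / (q^e; q^e)_n. *)
Lemma eqm_ppart e M n D lo : (0 < e)%N ->
  eqm M (qpoch A e n * ppart e M n D lo)
        'X^(e * (n * lo + \sum_(x < n.-1 | D x) x.+1)).
Proof.
move=> he; elim: n lo => [|n IH] lo.
  rewrite /qpoch /ppart big_ord0 mul1r (big_pred1 (ffun0 (card_ord 0))).
    by rewrite !big_ord0 mul0n addn0 muln0.
  move=> s /=; apply/esym/eqP/ffunP => -[] //.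
have -> : qpoch A e n.+1 * ppart e M n.+1 D lo = (1 - 'X^(e * n.+1)) *
    \sum_(a < M) (if (lo <= a)%N then 'X^(e * a) else 0) *
      (qpoch A e n * ppart e M n D (a + D n.-1)%N).
  rewrite qpochS ppartS mulrAC mulrC; congr (_ * _).
  by rewrite big_distrr /=; apply: eq_bigr => a _; ring.
apply: eqm_trans.
  by apply/eqmMl/eqm_sum => a _; apply/eqmMl/IH.
set w := (\sum_(x < n.+1.-1 | D x) x.+1)%N.
have -> : (1 - 'X^(e * n.+1)) * \sum_(a < M) (if (lo <= a)%N then 'X^(e * a) else 0) *
     'X^(e * (n * (a + D n.-1) + \sum_(x < n.-1 | D x) x.+1)) =
   'X^(e * w) * ((1 - 'X^(e * n.+1)) *
     \sum_(a < M) (if (lo <= a)%N then 'X^(e * n.+1 * a) else 0)) :> {poly A}.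
  rewrite mulrCA; congr (_ * _); rewrite big_distrr /=; apply: eq_bigr => a _.
  case: ifP => _; last by rewrite mul0r mulr0.
  rewrite -!exprD; congr ('X^_).
  have -> : w = (\sum_(x < n.-1 | D x) x.+1 + n * D n.-1)%N.
    rewrite /w; case: (n) => [|m] /=; first by rewrite !big_ord0.
    by rewrite !(big_mkcond (fun x => D _)) /= big_ord_recr /=; case: (D m); lia.
  by rewrite !mulnDr -!mulnA mulSn mulnDr; ring.
apply: eqm_trans; first by apply: eqmMl; apply: eqm_geometric; rewrite muln_gt0 he.
by rewrite -exprD -mulnA -mulnDr addnC.
Qed.

End DescentSequences.

(** * The transfer matrix and Newton's identities *)

Lemma det_rank1_update (S : comNzRingType) n (A : 'M[S]_n) (c : 'cV[S]_n) (r : 'rV[S]_n) :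
  exists k, forall s, \det (A + s *: (c *m r)) = \det A + s * k.
Proof.
pose B (u : S) (v : 'rV[S]_n) : 'M[S]_(1 + n) := block_mx u%:M v r^T A^T.
exists (\det (B 0 (- c^T))) => s.
have -> : \det (A + s *: (c *m r)) = \det (B 1 (- (s *: c^T))).
  rewrite -[in RHS]det_tr tr_block_mx trmx1 !trmxK.
  (* A column operation clears [r] from the border and leaves the updated matrix as a diagonal
     block. *)
  have h : block_mx 1 r (- (s *: c^T))^T A *m block_mx 1%:M (- r) 0 1%:M =
     block_mx 1%:M 0 (- (s *: c^T))^T (A + s *: (c *m r)) :> 'M_(1 + n).
    rewrite mulmx_block !mulmx1 !mulmx0 !mul1mx !addr0 linearN /= linearZ /= trmxK.
    by rewrite addNr mulmxN mulNmx opprK -scalemxAl [_ + A]addrC.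
  have := congr1 determinant h.
  by rewrite det_mulmx det_ublock det_lblock !det1 !mulr1 !mul1r => <-.
have -> : \det A = \det (B 1 0) by rewrite det_lblock det1 mul1r det_tr.
(* The determinant is linear in the first row, here (1, 0) + s (0, - c^T). *)
rewrite -[\det (B 1 0)]mul1r; apply: (@determinant_multilinear _ _ _ _ _ (lshift n 0)).
- rewrite /B /block_mx !rowKu; apply/matrixP => i j; rewrite !mxE.
  case: (split_ordP j) => l _; rewrite !mxE; last by ring.
  by rewrite mul0rn mulr0 mul1r addr0.
- apply/matrixP => i j; rewrite !mxE.
  by case: (split_ordP (lift _ i)) => k hk //; have := congr1 val hk; rewrite /= /bump /=; have := ltn_ord k; lia.
- apply/matrixP => i j; rewrite !mxE.
  by case: (split_ordP (lift _ i)) => k hk //; have := congr1 val hk; rewrite /= /bump /=; have := ltn_ord k; lia.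
Qed.

Section Transfer.
Variables (R : comNzRingType) (t : R).

(** Total weight of the letter a before b, over both choices of bar, a bar weighing t; equal letters
    allow both choices. *)
Definition stepw (a b : nat) : R :=
  if (a < b)%N then 1 else if (b < a)%N then t else 1 + t.

Definition transfer M (x : 'I_M -> R) : 'M[R]_M := \matrix_(a, b) (x a * stepw a b).

Definition revchar M (x : 'I_M -> R) : 'M[{poly R}]_M :=
  1%:M - 'X *: map_mx polyC (transfer x).

(* With J the all-ones matrix, det(1 - zX(N + sJ)) is affine in s, and N + sJ is triangular
   for s = -1 and for s = -t. *)
Lemma det_revchar M (x : 'I_M -> R) :
  (1 - t)%:P * \det (revchar x) =
  \prod_a (1 - (x a)%:P * 'X) - t%:P * \prod_a (1 - (t * x a)%:P * 'X).
Proof.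
pose c : 'cV[{poly R}]_M := \col_a (- (x a)%:P * 'X).
pose r : 'rV[{poly R}]_M := const_mx 1.
have [k hk] := det_rank1_update (revchar x) c r.
have e1 : \prod_a (1 - (t * x a)%:P * 'X) = \det (revchar x) - k.
  have := hk (- 1); rewrite mulN1r => <-.
  rewrite det_trig; last first.
    apply/is_trig_mxP => i j hij; rewrite !mxE big_ord1 !mxE /stepw hij.
    by rewrite -val_eqE (ltn_eqF hij) /= mulr1; ring.
  apply: eq_bigr => i _; rewrite !mxE big_ord1 !mxE /stepw ltnn eqxx.
  rewrite !rmorphM rmorphD rmorph1; ring.
have e2 : \prod_a (1 - (x a)%:P * 'X) = \det (revchar x) - t%:P * k.
  have := hk (- t%:P); rewrite mulNr => <-.
  rewrite -det_tr det_trig; last first.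
    apply/is_trig_mxP => i j hij; rewrite !mxE big_ord1 !mxE /stepw hij.
    rewrite ltnNge (ltnW hij) /= -val_eqE (gtn_eqF hij) /= rmorphM; ring.
  apply: eq_bigr => i _; rewrite !mxE big_ord1 !mxE /stepw ltnn eqxx.
  rewrite !rmorphM rmorphD rmorph1; ring.
rewrite e1 e2 rmorphB rmorph1; ring.
Qed.

(** The weights depend only on the order of the letters, so a principal minor belongs to the
    alphabet without a. *)
Lemma minor_revchar M (x : 'I_M.+1 -> R) a :
  row' a (col' a (revchar x)) = revchar (fun i => x (lift a i)).
Proof.
apply/matrixP => i j; rewrite !mxE (inj_eq lift_inj) /stepw.
by rewrite !ltnNge !leq_bump2.
Qed.

(* [esgn x]`_j is the signed elementary symmetric function (-1)^j e_j(x). *)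
Definition esgn M (x : 'I_M -> R) : {poly R} := \prod_a (1 - (x a)%:P * 'X).

(** A squarefree monomial of degree j survives the deletion of each of the [M.+1] - j letters
    outside it. *)
Lemma sum_esgn_lift M (x : 'I_M.+1 -> R) :
  \sum_a esgn (fun i => x (lift a i)) = esgn x *+ M.+1 - 'X * (esgn x)^`().
Proof.
have key m (y : 'I_m -> R) : \sum_a \prod_(i | i != a) (1 - (y i)%:P * 'X) =
    esgn y *+ m - 'X * (esgn y)^`().
  elim: m y => [|m IH] y.
    by rewrite big_ord0 /esgn big_ord0 -polyC1 derivC mulr0 mulr0n subr0.
  have -> : esgn y = (1 - (y ord0)%:P * 'X) * esgn (fun i => y (lift ord0 i)).
    by rewrite /esgn big_ord_recl.
  have e0 : \prod_(i | i != ord0) (1 - (y i)%:P * 'X) = esgn (fun i => y (lift ord0 i)).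
    by rewrite big_mkcond big_ord_recl /= mul1r; apply: eq_bigr.
  have e1 a : \prod_(i | i != lift ord0 a) (1 - (y i)%:P * 'X) =
      (1 - (y ord0)%:P * 'X) * \prod_(i | i != a) (1 - (y (lift ord0 i))%:P * 'X).
    rewrite big_mkcond big_ord_recl /= (big_mkcond (fun i => i != a)) /=.
    by congr (_ * _); apply: eq_bigr => i _; rewrite (inj_eq lift_inj).
  rewrite big_ord_recl e0 (eq_bigr _ (fun a _ => e1 a)) -big_distrr /= IH.
  have d1 : (1 - (y ord0)%:P * 'X)^`() = - (y ord0)%:P.
    by rewrite derivB deriv_mulC derivX mulr1 -polyC1 derivC sub0r.
  rewrite derivM d1 mulrS; move: (esgn _) => E; rewrite -mulrnAr; ring.
rewrite -key; apply: eq_bigr => a _; rewrite /esgn [RHS](reindex_omap (lift a) (unlift a)) /=.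
  by apply: eq_bigl => i; rewrite liftK eqxx eq_sym neq_lift.
by move=> i; case: unliftP => [k ->|->]; rewrite ?eqxx.
Qed.

Lemma coef_esgn_scale M (x : 'I_M -> R) j :
  (esgn (fun a => t * x a))`_j = t ^+ j * (esgn x)`_j.
Proof.
rewrite /esgn; elim: M x j => [|M IH] x j.
  rewrite !big_ord0 coef1; case: eqP => [->|_]; by rewrite ?mulr0 ?expr0 ?mulr1.
rewrite !big_ord_recl !mulrBl !mul1r !coefB IH -!mulrA !coefCM !coefXM.
case: j => [|j] /=; first by rewrite !mulr0 !subr0.
rewrite IH exprS; ring.
Qed.

Lemma qintE j : (1 - t) * qint j t = 1 - t ^+ j.
Proof. by rewrite -[RHS]opprB subrX1 -mulNr opprB. Qed.

(** In E(z) - t E(tz) the coefficient of degree j is scaled by 1 - t^(j+1), and the regular factor 1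
    - t cancels. *)
Lemma coef_det_revchar M (x : 'I_M -> R) j : GRing.lreg (1 - t) ->
  (\det (revchar x))`_j = qint j.+1 t * (esgn x)`_j.
Proof.
move=> ht; apply: ht; rewrite -coefCM det_revchar coefB coefCM coef_esgn_scale.
rewrite [RHS]mulrA qintE exprS /esgn; ring.
Qed.

Lemma tr_revchar_adj M (x : 'I_M.+1 -> R) j : GRing.lreg (1 - t) ->
  (\tr (\adj (revchar x)))`_j = qint j.+1 t * (esgn x)`_j * (M.+1%:R - j%:R).
Proof.
move=> ht; rewrite /mxtrace.
under eq_bigr => a _ do
  rewrite mxE /cofactor addnn -signr_odd odd_double expr0 mul1r minor_revchar.
rewrite coef_sum; under eq_bigr => a _ do rewrite coef_det_revchar //.
rewrite -big_distrr /= -coef_sum sum_esgn_lift coefB coefMn coefXM coef_deriv.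
by case: j => [|j] /=; ring.
Qed.

(** This is the coefficient of z^n in adj(1 - zN) = det(1 - zN) \sum_i (zN)^i, the series being cut
    off by the factor 1 - (zN)^(n+1). *)
Lemma sum_trace_revchar M (x : 'I_M.+1 -> R) n :
  \sum_(j < n.+1) (\det (revchar x))`_j * \tr (transfer x ^+ (n - j)) =
  (\tr (\adj (revchar x)))`_n.
Proof.
pose B : 'M[{poly R}]_M.+1 := 'X *: map_mx polyC (transfer x).
have hB i : B ^+ i = 'X^i *: map_mx polyC (transfer x ^+ i).
  by rewrite exprZn rmorphXn.
have h : \adj (revchar x) * (1 - B ^+ n.+1) =
    (\det (revchar x))%:M * \sum_(i < n.+1) B ^+ i.
  rewrite -mul_adj_mx -[_ *m _]/(_ * _) -mulrA; congr (_ * _).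
  by rewrite -[1 - _]opprB subrX1 -mulNr opprB.
have := congr1 (fun Z : 'M[{poly R}]_M.+1 => (\tr Z)`_n) h.
rewrite mulrBr mulr1 linearB /= coefB hB.
rewrite -[_ * (_ *: _)]/(_ *m _) -scalemxAr mxtraceZ coefXnM ltnSn subr0 => ->.
rewrite -[_ * _]/(_ *m _) mul_scalar_mx mxtraceZ coefM.
apply: eq_bigr => j _; congr (_ * _).
rewrite linear_sum /= coef_sum.
have hj : (n - j < n.+1)%N by rewrite ltnS leq_subr.
rewrite (bigD1 (Ordinal hj)) //= big1 ?addr0 => [|i /eqP hi].
  by rewrite hB mxtraceZ coefXnM ltnn subnn trace_map_mx coefC.
rewrite hB mxtraceZ coefXnM trace_map_mx coefC; case: ltnP => // h1.
by case: eqP => // h2; case: hi; apply: val_inj => /=; lia.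
Qed.

(** The term j = n carries the factor [M.+1], the trace of the adjugate [M.+1] - n; the difference
    is the right-hand side. *)
Lemma newton_transfer M (x : 'I_M.+1 -> R) n : GRing.lreg (1 - t) ->
  \sum_(j < n) qint j.+1 t * (esgn x)`_j * \tr (transfer x ^+ (n - j)) =
  - (n%:R * qint n.+1 t * (esgn x)`_n).
Proof.
move=> ht; have := sum_trace_revchar x n; rewrite big_ord_recr /= subnn expr0.
rewrite mxtrace1 tr_revchar_adj // coef_det_revchar // => h.
under eq_bigr => j _ do rewrite -coef_det_revchar //.
move/(canRL (addrK _)): h => ->; ring.
Qed.
End Transfer.

(** * Traces of powers as sums over circular words *)

Lemma expr_paths (R : comNzRingType) M (A : 'M[R]_M.+1) n b c :
  (A ^+ n.+1) b c = \sum_(w : {ffun 'I_n.+1 -> 'I_M.+1})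
    (if w ord0 == b then \prod_i A (w i) (nxt w c i) else 0).
Proof.
elim: n c => [|n IH] c.
  rewrite expr1 sum_snoc (bigD1 b) //= [X in _ + X]big1 ?addr0.
    rewrite (big_pred1 (ffun0 (card_ord 0))); last first.
      by move=> s /=; apply/esym/eqP/ffunP => -[].
    rewrite (_ : ord0 = ord_max); last exact: val_inj.
    by rewrite snoc_max eqxx big_ord1 (_ : ord0 = ord_max) ?snoc_max ?nxt_snoc_max //; exact: val_inj.
  move=> a hab; apply: big1 => s _.
  rewrite (_ : ord0 = ord_max); last exact: val_inj.
  by rewrite snoc_max (negPf hab).
rewrite sum_snoc exprSr mxE; apply: eq_bigr => a _; rewrite IH big_distrl /=.
apply: eq_bigr => s _; rewrite (_ : ord0 = widen_ord (leqnSn n.+1) ord0); last exact: val_inj.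
rewrite snoc_widen; case: ifP => _; last by rewrite mul0r.
rewrite [RHS]big_ord_recr /= snoc_max nxt_snoc_max; congr (_ * _).
by apply: eq_bigr => i _; rewrite snoc_widen nxt_snoc_widen.
Qed.

Lemma trace_words (R : comNzRingType) M (A : 'M[R]_M.+1) n :
  \tr (A ^+ n.+1) =
  \sum_(w : {ffun 'I_n.+1 -> 'I_M.+1}) \prod_i A (w i) (w (ordS i)).
Proof.
rewrite /mxtrace; under eq_bigr => b _ do rewrite expr_paths.
rewrite exchange_big /=; apply: eq_bigr => w _.
rewrite (bigD1 (w ord0)) //= eqxx [X in _ + X]big1 ?addr0; last first.
  by move=> b hb; rewrite eq_sym (negPf hb).
apply: eq_bigr => i _; congr (A _ _); rewrite /nxt; case: ltnP => // hi.
congr (w _); apply: val_inj => /=; have e : i.+1 = n.+1 by have := ltn_ord i; lia.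
by rewrite e modnn.
Qed.

(** * The statistic exd and its relation to maj *)

Section Exd.
Variable n : nat.
Implicit Types s : 'S_n.

Definition exc_at s (x : 'I_n) : bool := (x < s x)%N.

(* Exd is the descent set of s after barring the values s x > x and placing every barred
   letter below every unbarred one. *)
Definition exd_at s (x : 'I_n) : bool :=
  if exc_at s x == exc_at s (ordS x) then (s (ordS x) < s x)%N else ~~ exc_at s x.

Definition exd s : nat := (\sum_(x < n | (x.+1 < n) && exd_at s x) x.+1)%N.

Lemma excE s : exc s = (\sum_x exc_at s x)%N.
Proof.
rewrite /exc -sum1dep_card big_mkcond /=; apply: eq_bigr => x _.
by rewrite /exc_at; case: (ltnP x) => h; rewrite ?andbF // (leq_trans _ (ltn_ord (s x))).
Qed.

End Exd.

Lemma sum_by_parts (e : nat -> nat) m :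
  (\sum_(k < m) k.+1 * e k + m * e m =
   \sum_(k < m) k.+1 * e k.+1 + \sum_(k < m) e k)%N.
Proof.
elim: m => [|m IH]; first by rewrite !big_ord0.
rewrite !big_ord_recr /= mulSn.
have aux a b c x y z : (a + y = b + c -> a + (x + y) + z = b + z + (c + x))%N by lia.
exact: aux.
Qed.

(* A descent that is not in Exd is an excedance followed
   by a non-excedance, and the other way round. *)
Lemma maj_exd n (s : 'S_n) : maj s = (exd s + exc s)%N.
Proof.
case: n s => [|n] s; first by rewrite excE /maj /exd !big_ord0.
pose e k := nat_of_bool (exc_at s (inord k)).
have eE (x : 'I_n.+1) : e x = exc_at s x by rewrite /e inord_val.
(* The last position is no excedance, so the boundary term of the summation by parts vanishes. *)
have en : e n = 0%N.
  by rewrite /e /exc_at inordK // ltnNge -ltnS ltn_ord.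
(* At each k, the descent indicator plus the excedance at k + 1 equals the [exd_at] indicator plus
   the excedance at k. *)
have key : (\sum_(k < n) k.+1 * ((s (inord k.+1) < s (inord k)) : nat) +
    \sum_(k < n) k.+1 * e k.+1 = \sum_(k < n) k.+1 * exd_at s (inord k) +
    \sum_(k < n) k.+1 * e k)%N.
  rewrite -!big_split /=; apply: eq_bigr => k _; rewrite -!mulnDr; congr (_ * _)%N.
  have hk := ltn_ord k.
  have Sk : ordS (inord k : 'I_n.+1) = inord k.+1.
    by apply: val_inj; rewrite /= !inordK ?modn_small // ltnS // ltnW.
  rewrite /exd_at /e Sk /exc_at !inordK ?ltnS //; last exact: ltnW.
  have : (s (inord k) : nat) <> s (inord k.+1).
    move/val_inj/perm_inj/(congr1 val); rewrite /= !inordK ?ltnS //; last exact: ltnW.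
    by lia.
  move: (s (inord k) : nat) (s (inord k.+1) : nat) => a b.
  by case: (ltnP a b); case: (ltnP b a); case: (ltnP k a); case: (ltnP k.+1 b) => /=; lia.
have toN (D : 'I_n.+1 -> bool) : (\sum_(x < n.+1 | (x.+1 < n.+1) && D x) x.+1 =
    \sum_(k < n) k.+1 * D (inord k))%N.
  rewrite big_mkcond big_ord_recr /= ltnn addn0; apply: eq_bigr => k _.
  rewrite ltnS ltn_ord /= (_ : widen_ord _ k = inord k); last first.
    by apply: val_inj; rewrite /= inordK // ltnS ltnW.
  by case: (D _); rewrite ?muln1 ?muln0.
have -> : maj s = (\sum_(k < n) k.+1 * ((s (inord k.+1) < s (inord k)) : nat))%N.
  rewrite /maj toN; apply: eq_bigr => k _; congr (_ * (_ < _))%N.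
  congr (val (s _)); apply: val_inj; have hk := ltn_ord k.
  by rewrite /= !inordK ?modn_small // ltnS // ltnW.
rewrite /exd toN excE big_ord_recr /=.
have -> : exc_at s ord_max = false.
  by rewrite /exc_at ltnNge -ltnS ltn_ord.
have -> : (\sum_(i < n) exc_at s (widen_ord (leqnSn n) i) = \sum_(k < n) e k)%N.
  by apply: eq_bigr => k _; rewrite -eE.
have := sum_by_parts e n; rewrite en muln0 !addn0.
have aux a b c x y : (a + x = b + y -> y = x + c -> a = b + c)%N by lia.
exact: aux.
Qed.

(** * Full cycles as conjugates of the rotation *)

Section Conjugates.
Variable n : nat.

Definition shift_perm : 'S_n.+1 := perm (@ordS_inj n.+1).

Lemma is_ncycleP (s : 'S_n.+1) :
  reflect (forall x y, y \in porbit s x) (is_ncycle s).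
Proof.
apply: (iffP eqP) => [h x y|h].
  have : porbit s x \in porbits s by apply: imset_f.
  by rewrite h inE => /eqP->.
apply/setP => B; rewrite inE; apply/imsetP/eqP => [[x _ ->]|->].
  by apply/setP => y; rewrite h inE.
by exists ord0 => //; apply/setP => y; rewrite h inE.
Qed.

Lemma shift_permX k (i : 'I_n.+1) : ((shift_perm ^+ k)%g i : nat) = ((i + k) %% n.+1)%N.
Proof.
rewrite permX; elim: k => [|k IH]; first by rewrite addn0 modn_small.
by rewrite iterS permE /= IH -addn1 modnDml addn1 addnS.
Qed.

Lemma is_ncycle_conj (r : 'S_n.+1) : is_ncycle (shift_perm ^ r)%g.
Proof.
apply/is_ncycleP => x y; rewrite -(permKV r x) -(permKV r y).
move: (_ x) (_ y) => i j; apply/porbitP.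
exists (j + (n.+1 - i))%N; rewrite -conjXg permJ; congr (r _).
apply: val_inj; rewrite /= shift_permX.
rewrite addnCA subnKC; last exact: ltnW.
by rewrite modnDr modn_small.
Qed.

Lemma ncycle_conjE (s r : 'S_n.+1) :
  (shift_perm ^ r == s)%g = [forall i, s (r i) == r (ordS i)].
Proof.
apply/eqP/forallP => [<- i|h]; first by rewrite permJ permE.
apply/permP => x; rewrite -(permKV r x) permJ permE.
by rewrite (eqP (h _)).
Qed.

(** A full cycle s is [shift_perm ^ r] for exactly one r with a given value x at [ord0], namely r i
    = s^i x. *)
Lemma sum_ncycles (V : nmodType) (f : 'S_n.+1 -> V) :
  (\sum_(s | is_ncycle s) f s) *+ n.+1 = \sum_r f (shift_perm ^ r)%g.
Proof.
rewrite -sumrMnl [RHS](partition_big (fun r => shift_perm ^ r)%g (@is_ncycle n.+1)) /=;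
  last by move=> r _; exact: is_ncycle_conj.
apply: eq_bigr => s /is_ncycleP hs.
have hcard x : #|porbit s x| = n.+1.
  by rewrite (_ : porbit s x = setT) ?cardsT ?card_ord //; apply/setP => y; rewrite hs inE.
have inj x : injective (fun i : 'I_n.+1 => (s ^+ i)%g x).
  move=> i j; rewrite !permX => e; apply/val_inj/eqP => /=.
  have := uniq_traject_porbit s x; rewrite hcard => hu.
  rewrite -(nth_uniq x _ _ hu) ?size_traject //.
  by rewrite !nth_traject // e.
rewrite (reindex_onto (fun x => perm (inj x)) (fun r : 'S_n.+1 => r ord0)) /=.
  rewrite (eq_bigr (fun=> f s)) => [|x /andP[/eqP-> _]] //.
  rewrite (eq_bigl predT) => [|x]; first by rewrite sumr_const card_ord.
  rewrite permE expg0 perm1 eqxx andbT ncycle_conjE; apply/forallP => i.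
  rewrite !permE /= -permM -expgSr; apply/eqP.
  case: (ltnP i.+1 n.+1) => hi; first by rewrite modn_small.
  have -> : i.+1 = n.+1 by have := ltn_ord i; lia.
  by rewrite modnn expg0 perm1 permX; have := iter_porbit s x; rewrite hcard.
move=> r; rewrite ncycle_conjE => /forallP h; apply/permP => i; rewrite permE.
case: i => i /=; elim: i => [|i IH] hi.
  by rewrite expg0 perm1; congr (r _); apply: val_inj.
rewrite expgSr permM (IH (ltnW hi)) (eqP (h _)); congr (r _).
by apply: val_inj; rewrite /= modn_small.
Qed.

End Conjugates.

(** * Rotations and their lexicographic keys *)

Section Rotation.
Variable n : nat.
Implicit Types i j : 'I_n.+1.

Lemma iter_ordS m i : (iter m (@ordS _) i : nat) = ((i + m) %% n.+1)%N.
Proof.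
elim: m => [|m IH]; first by rewrite addn0 modn_small.
by rewrite iterS /= IH -addn1 modnDml addn1 addnS.
Qed.

Lemma iter_ordS_id i : iter n.+1 (@ordS _) i = i.
Proof. by apply: val_inj; rewrite [LHS]iter_ordS modnDr modn_small. Qed.

Lemma iter_ordS_surj i j : exists m, j = iter m (@ordS _) i.
Proof.
exists (j + (n.+1 - i))%N; apply: val_inj; rewrite [RHS]iter_ordS.
by rewrite addnCA subnKC ?modnDr ?modn_small // ltnW.
Qed.

Lemma iter_ordS_neq m i : (0 < m < n.+1)%N -> iter m (@ordS _) i != i.
Proof.
move=> /andP[m0 mn]; apply/eqP => /(congr1 val); rewrite /= iter_ordS.
rewrite -[RHS](modn_small (ltn_ord i)) => /eqP.
rewrite -{2}[val i]addn0 eqn_modDl mod0n modn_small // => /eqP; lia.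
Qed.

End Rotation.

Section Key.
Variables (n B : nat) (f : 'I_n.+1 -> nat).
Hypothesis fB : forall i, (f i + 2 <= B)%N.

(* The rotation of the word f starting at i, read as a number in base B; numeric
   order is lexicographic order. *)
Definition key (i : 'I_n.+1) : nat :=
  (\sum_(j < n.+1) f (iter j (@ordS _) i) * B ^ (n - j))%N.

(** Multiplying by B and adding the unit digit f i gives the digits of the next rotation, preceded
    by the old leading digit. *)
Lemma key_rec i : (B * key i + f i = f i * B ^ n.+1 + key (ordS i))%N.
Proof.
rewrite /key big_ord_recl [X in (_ = _ + X)%N]big_ord_recr /= subn0 subnn expn0 muln1.
rewrite -iterSr iter_ordS_id mulnDr addnA; congr (_ + _)%N.
rewrite mulnCA -expnS; congr (_ + _)%N; rewrite big_distrr /=.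
apply: eq_bigr => j _; rewrite mulnCA -expnS /bump /= add1n -iterSr.
by congr (_ * B ^ _)%N; have := ltn_ord j; lia.
Qed.

(** Digits at most B - 2 keep every key below P - 1, where P = B^(n+1). As B key i = f i (P - 1) +
    key (ordS i), a larger first digit then outweighs the rest, which gives [key_lt]. *)
Lemma key_bound i : (key i + 2 <= B ^ n.+1)%N.
Proof.
have h m (g : nat -> nat) : (forall k, g k + 2 <= B)%N ->
    (\sum_(j < m) g j * B ^ (m.-1 - j) + 1 <= B ^ m)%N.
  move=> hg; elim: m => [|m IH]; first by rewrite big_ord0.
  rewrite big_ord_recr /= subnn muln1.
  have -> : (\sum_(j < m) g j * B ^ (m - j) = (\sum_(j < m) g j * B ^ (m.-1 - j)) * B)%N.
    rewrite big_distrl /=; apply: eq_bigr => j _; rewrite -mulnA -expnSr.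
    by congr (_ * B ^ _)%N; have := ltn_ord j; lia.
  have := hg m; rewrite expnS; nia.
rewrite /key big_ord_recr /= subnn muln1.
have -> : (\sum_(j < n) f (iter j (@ordS _) i) * B ^ (n - j) =
    (\sum_(j < n) f (iter j (@ordS _) i) * B ^ (n.-1 - j)) * B)%N.
  rewrite big_distrl /=; apply: eq_bigr => j _; rewrite -mulnA -expnSr.
  by congr (_ * B ^ _)%N; have := ltn_ord j; lia.
have := h n (fun k => f (iter k (@ordS _) i)) (fun k => fB _).
have := fB (iter n (@ordS _) i); rewrite expnS; nia.
Qed.

Lemma key_lt i j : (f j < f i)%N -> (key j < key i)%N.
Proof.
move=> h; have := key_rec i; have := key_rec j; have := key_bound (ordS j).
have := key_bound (ordS i); move: (key _) (key (ordS i)) (key j) (key (ordS j)) => a b c d.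
move: (B ^ n.+1)%N => P h1 h2 h3 h4.
have e : f i = (f j + (f i - f j))%N by lia.
have hd : (0 < f i - f j)%N by lia.
rewrite e in h4; move: (f i - f j)%N hd h4 => k hk h4.
rewrite ltnNge; apply/negP => hac; have := leq_mul (leqnn B) hac; nia.
Qed.

Lemma key_eqf i j : f i = f j -> (key j < key i)%N = (key (ordS j) < key (ordS i))%N.
Proof.
move=> h; have := key_rec i; have := key_rec j; rewrite h.
have B0 : (0 < B)%N by have := fB i; lia.
rewrite -(ltn_pmul2l B0); move: (B * _)%N (B * key j)%N (_ * _)%N => a b c h1 h2.
by apply/idP/idP; lia.
Qed.

End Key.

(** * Permutations as rankings *)

Lemma card_ltn_perm n (r : 'S_n) i : #|[set j | (r j < r i)%N]| = r i.
Proof.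
rewrite (_ : [set j | _] = r @^-1: [set x : 'I_n | (x < r i)%N]); last first.
  by apply/setP => j; rewrite !inE.
rewrite card_preimset; last exact: perm_inj.
rewrite -sum1dep_card -(big_ord_widen n (fun=> 1%N)) ?sum_nat_const ?card_ord ?muln1 //.
exact: ltnW.
Qed.

Lemma perm_ltn_inj n (r r' : 'S_n) :
  (forall i j, (r i < r j)%N = (r' i < r' j)%N) -> r = r'.
Proof.
move=> h; apply/permP => i; apply: val_inj.
rewrite /= -card_ltn_perm -[RHS]card_ltn_perm; congr #|pred_of_set _|.
by apply/setP => j; rewrite !inE h.
Qed.

(** The rank is the number of larger keys: the order is reversed, since labels decrease along the
    positions. *)
Lemma rank_perm n (k : 'I_n -> nat) : injective k ->
  exists r : 'S_n, forall i j, (r i < r j)%N = (k j < k i)%N.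
Proof.
move=> kI; pose S i := [set j | (k i < k j)%N].
have SI i j : (k j < k i)%N -> (#|S i| < #|S j|)%N.
  move=> h; apply/proper_card/properP; split.
    by apply/subsetP => l; rewrite !inE; apply: ltn_trans.
  by exists i; rewrite !inE ?ltnn.
have Sn i : (#|S i| < n)%N.
  rewrite -[X in (_ < X)%N]card_ord -cardsT; apply/proper_card/properP.
  by split; [apply/subsetP => l; rewrite inE | exists i; rewrite !inE ?ltnn].
have inj : injective (fun i => Ordinal (Sn i)).
  move=> i j /(congr1 val) /= e; apply: kI; apply/eqP.
  by case: ltngtP => // /SI; rewrite e ltnn.
exists (perm inj) => i j; rewrite !permE /=; case: (ltngtP (k j) (k i)) => h.
- by rewrite SI.
- by rewrite ltnNge ltnW // SI.
- by rewrite (kI _ _ h) ltnn.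
Qed.

(** * The bijection between labelled cycles and primitive words *)

Section Words.
Variables (n M : nat).
Notation word := {ffun 'I_n.+1 -> bool * 'I_M}.
Implicit Types w : word.

(* A letter (b, a) is the letter a, barred when b holds: the next letter must then be
   at most a, and at least a otherwise. *)
Definition stepv (l l' : bool * 'I_M) : bool :=
  if l.1 then (l'.2 <= l.2)%N else (l.2 <= l'.2)%N.

Definition valid w : bool := [forall i, stepv (w i) (w (ordS i))].

Definition primitive w : bool :=
  [forall m : 'I_n.+1, (0 < m)%N ==> [exists i, w (iter m (@ordS _) i) != w i]].

(** Letters are ordered by value, a barred letter just above its unbarred copy. *)
Definition code (l : bool * 'I_M) : nat := (l.2.*2 + l.1)%N.

Lemma code_inj : injective code.
Proof.
move=> [b a] [b' a'] h; rewrite /code /= in h.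
by congr (_, _); last apply: val_inj; move: h; case: b; case: b' => /=; lia.
Qed.

Lemma code_bound l : (code l + 2 <= M.*2.+1)%N.
Proof. by rewrite /code; have := ltn_ord l.2; case: l.1; lia. Qed.

Notation wkey w := (key M.*2.+1 (fun i => code (w i))).

Lemma wkey_lt w i j : (code (w j) < code (w i))%N -> (wkey w j < wkey w i)%N.
Proof. by apply: key_lt => l; apply: code_bound. Qed.

Lemma wkey_le w i j : (wkey w i <= wkey w j)%N -> (code (w i) <= code (w j))%N.
Proof. by rewrite leqNgt => h; rewrite leqNgt; apply: contra h; apply: wkey_lt. Qed.

Lemma wkey_eq w i j : w i = w j ->
  (wkey w j < wkey w i)%N = (wkey w (ordS j) < wkey w (ordS i))%N.
Proof. by move=> h; apply: key_eqf; rewrite ?h // => l; apply: code_bound. Qed.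

(** Equal keys have equal first letters and stay equal after rotation, so w would be invariant under
    the rotation from i to j. *)
Lemma wkey_inj w : primitive w -> injective (wkey w).
Proof.
move=> /forallP hw i j e; apply/eqP/contraT => hij.
have h m : wkey w (iter m (@ordS _) i) = wkey w (iter m (@ordS _) j) /\
           w (iter m (@ordS _) i) = w (iter m (@ordS _) j).
  have aux a b : wkey w a = wkey w b -> w a = w b.
    by move=> eab; apply/code_inj/eqP; rewrite eqn_leq !wkey_le // eab.
  elim: m => [|m [IH1 IH2]]; first by split => //; apply: aux.
  have e' : wkey w (iter m.+1 (@ordS _) i) = wkey w (iter m.+1 (@ordS _) j).
    rewrite !iterS.
    case: (ltngtP (wkey w (ordS (iter m (@ordS _) i))) (wkey w (ordS (iter m (@ordS _) j)))) => //.
      by rewrite -(wkey_eq (esym IH2)) IH1 ltnn.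
    by rewrite -(wkey_eq IH2) IH1 ltnn.
  by split => //; apply: aux.
have [m jm] := iter_ordS_surj i j.
have hm : (m %% n.+1 < n.+1)%N by rewrite ltn_mod.
have jm' (x : 'I_n.+1) : iter m (@ordS _) x = iter (m %% n.+1) (@ordS _) x.
  by apply: ord_inj; rewrite !iter_ordS modnDmr.
have m0 : (0 < m %% n.+1)%N.
  by rewrite lt0n; apply: contra hij => /eqP m0; rewrite jm jm' m0.
have := hw (Ordinal hm); rewrite /= m0 => /existsP[x].
have [k ->] := iter_ordS_surj i x.
by rewrite -jm' -iterD addnC iterD -jm; case: (h k) => _ ->; rewrite eqxx.
Qed.

Lemma wkey_primitive w : injective (wkey w) -> primitive w.
Proof.
move=> kI; apply/forallP => m; apply/implyP => m0; apply/contraT => /existsPn h.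
have e i : w (iter m (@ordS _) i) = w i by apply/eqP; have := h i; rewrite negbK.
exfalso; have := @iter_ordS_neq n m ord0; rewrite m0 ltn_ord => /(_ isT) /eqP; apply.
apply: kI; rewrite /key; apply: eq_bigr => j _.
by rewrite -iterD addnC iterD e.
Qed.

(** If the bar disagreed with the comparison, validity would force the next letter to be equal, with
    the same comparison one step on. Around the circle the keys would be strictly monotone. *)
Lemma wkey_bar w i : (0 < n)%N -> valid w -> primitive w ->
  (w i).1 = (wkey w (ordS i) < wkey w i)%N.
Proof.
move=> n0 /forallP hv hp; have kI := wkey_inj hp.
have nS (x : 'I_n.+1) : ordS x != x by apply: (@iter_ordS_neq n 1).
have step x : (wkey w (ordS x) < wkey w x)%N != (w x).1 ->
    w (ordS x) = w x /\
    (wkey w (ordS (ordS x)) < wkey w (ordS x))%N = (wkey w (ordS x) < wkey w x)%N.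
  move=> hb; have e : w (ordS x) = w x.
    have := hv x; rewrite /stepv; apply: contraTeq => /eqP hne.
    have : code (w (ordS x)) <> code (w x) by move/code_inj.
    by move: hb; case: ltnP => [/ltnW|] /wkey_le; rewrite /code; case: (w x).1 => //=;
      case: (w (ordS x)).1 => /=; lia.
  by split => //; rewrite -(wkey_eq (esym e)).
apply/eqP/contraT; rewrite eq_sym => hb.
have h m : w (iter m (@ordS _) i) = w i /\
    (wkey w (iter m.+1 (@ordS _) i) < wkey w (iter m (@ordS _) i))%N =
    (wkey w (ordS i) < wkey w i)%N.
  elim: m => [|m [IH1 IH2]] //.
  have [|e1 e2] := step (iter m (@ordS _) i); first by rewrite -iterS IH2 IH1.
  by split; rewrite ?iterS ?e1 // e2.
case hlt: (wkey w (ordS i) < wkey w i)%N h => h.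
  have hm m : (wkey w (iter m.+1 (@ordS _) i) < wkey w i)%N.
    elim: m => [|m IH] //; have [_ hm] := h m.+1.
    exact: ltn_trans hm IH.
  by have := hm n; rewrite iter_ordS_id ltnn.
have h' m : (wkey w (iter m (@ordS _) i) < wkey w (iter m.+1 (@ordS _) i))%N.
  have [_ /negbT] := h m; rewrite -leqNgt leq_eqVlt => /orP[/eqP/kI e|//].
  by have := nS (iter m (@ordS _) i); rewrite -iterS -e eqxx.
have hm m : (wkey w i < wkey w (iter m.+1 (@ordS _) i))%N.
  elim: m => [|m IH]; first exact: (h' 0%N).
  exact: ltn_trans IH (h' m.+1).
by have := hm n; rewrite iter_ordS_id ltnn.
Qed.

(** The cycle [shift_perm ^ r] sends r i to r (i + 1), so [r] lists it in cyclic order and the bar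
    marks the excedances. *)
Definition word_of (r : 'S_n.+1) (s : {ffun 'I_n.+1 -> 'I_M}) : word :=
  [ffun i => ((r i < r (ordS i))%N, s (r i))].

Definition compat (r : 'S_n.+1) (s : {ffun 'I_n.+1 -> 'I_M}) : bool :=
  [forall x, low (fun k => exd_at (shift_perm n ^ r)%g (inord k)) 0 s x <= s x]%N.

(** A transitive extension to all pairs of the adjacent conditions in [compat]: larger labels first,
    then excedances, then smaller images. *)
Definition before (r : 'S_n.+1) (s : {ffun 'I_n.+1 -> 'I_M}) (x y : 'I_n.+1) : bool :=
  let g := (shift_perm n ^ r)%g in
  (s y < s x)%N || (s x == s y) &&
    ((exc_at g y < exc_at g x)%N || (exc_at g x == exc_at g y) && (g x < g y)%N).

Lemma before_trans r s : transitive (before r s).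
Proof.
move=> y x z; rewrite /before -!val_eqE /=; set g := (_ ^ _)%g.
case/orP=> [h1|/andP[/eqP-> h1]] /orP[h2|/andP[/eqP<- h2]].
- by rewrite (ltn_trans h2 h1).
- by rewrite h1.
- by rewrite h2.
apply/orP; right; rewrite eqxx /=; move: h1 h2.
case: (exc_at g x); case: (exc_at g y); case: (exc_at g z) => //=; exact: ltn_trans.
Qed.

Lemma compatP r s : reflect (forall x y : 'I_n.+1, (x < y)%N -> before r s x y) (compat r s).
Proof.
have E (x : 'I_n.+1) : (x.+1 < n.+1)%N ->
    (low (fun k => exd_at (shift_perm n ^ r)%g (inord k)) 0 s x <= s x)%N =
    before r s x (ordS x).
  move=> hx; rewrite /low hx inord_val /before /exd_at -val_eqE /=.
  set g := (_ ^ _)%g; have : (g x : nat) <> g (ordS x).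
    move/val_inj/perm_inj/(congr1 val); rewrite /= modn_small //; lia.
  move: (s x : nat) (s (ordS x) : nat) (g x : nat) (g (ordS x) : nat) => a b c e hce.
  by case: (exc_at g x); case: (exc_at g (ordS x)) => /=; apply/idP/idP; lia.
apply: (iffP forallP) => h.
  have step d (x y : 'I_n.+1) : (y = x + d.+1 :> nat)%N -> before r s x y.
    elim: d y => [|d IH] y hy.
      rewrite (_ : y = ordS x); last first.
        by apply: val_inj; rewrite /= modn_small ?hy ?addn1 //; have := ltn_ord y; lia.
      by rewrite -E //; have := ltn_ord y; lia.
    have hd : (x + d.+1 < n.+1)%N by have := ltn_ord y; lia.
    apply: before_trans (IH (Ordinal hd) erefl) _.
    rewrite (_ : y = ordS (Ordinal hd)); last first.
      by apply: val_inj; rewrite /= modn_small ?hy ?addnS //; have := ltn_ord y; lia.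
    by rewrite -E //=; have := ltn_ord y; lia.
  by move=> x y hxy; apply: (step (y - x).-1); lia.
move=> x; case: (ltnP x.+1 n.+1) => hx; last by rewrite /low ltnNge hx.
by rewrite E //; apply: h; rewrite /= modn_small.
Qed.

Lemma conj_shift r i : (shift_perm n ^ r)%g (r i) = r (ordS i).
Proof. by rewrite permJ permE. Qed.

Lemma exc_at_conj r i : exc_at (shift_perm n ^ r)%g (r i) = (r i < r (ordS i))%N.
Proof. by rewrite /exc_at conj_shift. Qed.

(** Along the cycle, [before] is one step of lexicographic comparison: letters first, and on a tie
    the next positions. *)
Lemma beforeE r s i j : before r s (r i) (r j) =
  (code (word_of r s j) < code (word_of r s i))%N ||
  (word_of r s i == word_of r s j) && (r (ordS i) < r (ordS j))%N.
Proof.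
rewrite /before !exc_at_conj !conj_shift -(inj_eq code_inj) /code !ffunE /= -val_eqE /=.
move: (s (r i) : nat) (s (r j) : nat) => a b.
case: (r (ordS i) < _)%N; case: (r i < _)%N; case: (r j < _)%N => /=; by apply/idP/idP; lia.
Qed.

Lemma compat_le r s (x y : 'I_n.+1) : compat r s -> (x <= y)%N -> (s y <= s x)%N.
Proof.
move=> /compatP h; rewrite leq_eqVlt => /orP[/eqP/val_inj-> //|/h].
by rewrite /before => /orP[/ltnW|/andP[/eqP-> _]].
Qed.

Lemma valid_word_of r s : compat r s -> valid (word_of r s).
Proof.
move=> h; apply/forallP => i; rewrite /stepv !ffunE /=; case: ltnP => hi.
  by apply: compat_le h _; apply: ltnW.
exact: compat_le h _.
Qed.

Lemma wkey_word_of r s i j : compat r s ->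
  (wkey (word_of r s) j < wkey (word_of r s) i)%N = (r i < r j)%N.
Proof.
move=> /compatP hc; set w := word_of r s.
have hlt a b : (r a < r b)%N -> (wkey w b < wkey w a)%N.
  (* Otherwise the letters agree at every step and both inequalities persist under rotation. *)
  move=> hab; rewrite ltnNge; apply/negP => hk.
  have h m : (r (iter m (@ordS _) a) < r (iter m (@ordS _) b))%N /\
      (wkey w (iter m (@ordS _) a) <= wkey w (iter m (@ordS _) b))%N.
    elim: m => [|m [h1 h2]] //; have := hc _ _ h1; rewrite beforeE => /orP[/wkey_lt|].
      by rewrite -/w ltnNge h2.
    case/andP => /eqP e h3; split => //.
    by rewrite leqNgt -(wkey_eq e) -leqNgt.
  (* Rotating a to the last position [ord_max] leaves no room for the persistent inequality. *)
  have [m hm] := iter_ordS_surj a ((r^-1)%g ord_max).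
  by have [] := h m; rewrite -hm permKV ltnNge -ltnS ltn_ord.
case: (ltngtP (r i) (r j)) => [/hlt //|/hlt h|/val_inj/perm_inj->]; last exact: ltnn.
by rewrite ltnNge ltnW.
Qed.

Lemma primitive_word_of r s : compat r s -> primitive (word_of r s).
Proof.
move=> h; apply: wkey_primitive => i j e; apply: (@perm_inj _ r); apply: val_inj => /=.
by case: (ltngtP (r i) (r j)) => //; rewrite -(wkey_word_of _ _ h) e ltnn.
Qed.

Lemma word_of_inj r s r' s' : compat r s -> compat r' s' ->
  word_of r s = word_of r' s' -> r = r' /\ s = s'.
Proof.
move=> h h' e.
have er : r = r' by apply: perm_ltn_inj => i j; rewrite -!(wkey_word_of _ _ h, wkey_word_of _ _ h') e.
split=> //; apply/ffunP => x; have := congr1 (fun w : word => w ((r^-1)%g x)) e.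
by rewrite !ffunE -er permKV => -[].
Qed.

(** Ranking the rotations by decreasing key gives r; [wkey_bar] makes the excedances of its cycle
    agree with the bars. *)
Lemma word_of_surj w : (0 < n)%N -> valid w -> primitive w ->
  exists r, exists2 s, compat r s & word_of r s = w.
Proof.
move=> n0 hv hp; have [r hr] := rank_perm (wkey_inj hp).
pose s := [ffun x => (w ((r^-1)%g x)).2].
have e : word_of r s = w.
  apply/ffunP => i; rewrite !ffunE permK hr -wkey_bar //.
  by case: (w i).
exists r, s => //; apply/compatP => x y.
rewrite -(permKV r x) -(permKV r y); move: (_ x) (_ y) => i j hij.
rewrite beforeE e; move: hij; rewrite hr => hij.
case: ltngtP (wkey_le (ltnW hij)) => //= /code_inj ew _.
by rewrite ew eqxx hr -(wkey_eq (esym ew)).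
Qed.

Lemma sum_primitive (V : nmodType) (F : word -> V) : (0 < n)%N ->
  \sum_(w | valid w && primitive w) F w =
  \sum_r \sum_(s | compat r s) F (word_of r s).
Proof.
move=> n0; rewrite pair_big_dep /=.
pose C := [set p : 'S_n.+1 * {ffun 'I_n.+1 -> 'I_M} | compat p.1 p.2].
pose h (p : 'S_n.+1 * {ffun 'I_n.+1 -> 'I_M}) := word_of p.1 p.2.
have hI : {in C &, injective h}.
  move=> [r s] [r' s']; rewrite !inE /= => h1 h2 /word_of_inj.
  by case=> //= -> ->.
rewrite (eq_bigl (mem (h @: C))).
  by rewrite big_imset //=; apply: eq_bigl => p; rewrite inE.
move=> w; rewrite inE; apply/andP/imsetP => [[hv hp]|[[r s]]].
  have [r [s h1 h2]] := word_of_surj n0 hv hp.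
  by exists (r, s); rewrite ?inE.
by rewrite inE /= => hc ->; rewrite valid_word_of ?primitive_word_of.
Qed.

Section Weights.
Variables (A : comNzRingType) (t : A).

(** The weight of a letter of a word that is repeated e times. *)
Definition letterw e (l : bool * 'I_M) : {poly A} := (t ^+ (e * l.1))%:P * 'X^(e * l.2).

Definition cyclepoly e : {poly A} := \sum_(s : 'S_n.+1 | is_ncycle s)
  (t ^+ (e * exc s))%:P * 'X^(e * exd s).

(** For fixed r the words give t^exc times a [ppart] with descent set Exd; each cycle then arises
    from [n.+1] choices of r. *)
Lemma eqm_primitive e : (0 < n)%N -> (0 < e)%N ->
  eqm M (qpoch A e n.+1 *
      \sum_(w | valid w && primitive w) \prod_i letterw e (w i))
    (cyclepoly e *+ n.+1).
Proof.
move=> n0 e0; rewrite sum_primitive // sum_ncycles big_distrr /=.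
apply: eqm_sum => r _; set g := (_ ^ _)%g.
pose D k := exd_at g (inord k).
have -> : \sum_(s | compat r s) \prod_i letterw e (word_of r s i) =
    (t ^+ (e * exc g))%:P * ppart A e M n.+1 D 0.
  rewrite big_distrr /= big_mkcond; apply: eq_bigr => s _.
  case: ifP => hc; last first.
    have [x hx] : exists x, ~~ (low D 0 s x <= s x)%N.
      by apply/existsP; rewrite -negb_forall; apply: negbT hc.
    by rewrite (bigD1 x) //= (negPf hx) mul0r mulr0.
  rewrite big_split /= -rmorph_prod /=; congr (_ %:P * _).
    under eq_bigr => i _ do rewrite ffunE /=.
    rewrite prodrXr -big_distrr excE /=; congr (_ ^+ (_ * _)).
    by rewrite [RHS](reindex_inj (@perm_inj _ r)) /=; apply: eq_bigr => i _; rewrite exc_at_conj.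
  rewrite [RHS](reindex_inj (@perm_inj _ r)) /=; apply: eq_bigr => i _.
  by rewrite ffunE /=; have /forallP/(_ (r i)) -> := hc.
have -> : exd g = (n.+1 * 0 + \sum_(x < n.+1.-1 | D x) x.+1)%N.
  rewrite muln0 add0n /exd big_mkcond big_ord_recr /= ltnn addn0 [RHS]big_mkcond.
  apply: eq_bigr => k _; rewrite ltnS ltn_ord /= /D; congr (if exd_at g _ then _ else _).
  by apply: val_inj; rewrite /= inordK // ltnS ltnW.
by rewrite mulrCA; apply: eqmMl; apply: eqm_ppart.
Qed.

End Weights.
End Words.

(** * Least periods and repetitions of words *)

Section Periods.
Variable M : nat.
Notation T := (bool * 'I_M)%type.
Notation word n := {ffun 'I_n.+1 -> T}.

(** The periodic extension of w, through which words of different lengths are compared. *)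
Definition ext n (w : word n) (k : nat) : T := w (inord (k %% n.+1)).

Lemma ext_ord n (w : word n) (i : 'I_n.+1) : ext w i = w i.
Proof. by rewrite /ext modn_small // inord_val. Qed.

Lemma ext_iter n (w : word n) m (i : 'I_n.+1) : w (iter m (@ordS _) i) = ext w (i + m).
Proof.
rewrite /ext; congr (w _); apply: ord_inj.
by rewrite iter_ordS inordK // ltn_mod.
Qed.

Lemma ext_mod n (w : word n) k : ext w (k %% n.+1) = ext w k.
Proof. by rewrite /ext modn_mod. Qed.

Lemma ext_modD n (w : word n) k m : ext w (k %% n.+1 + m) = ext w (k + m).
Proof. by rewrite /ext modnDml. Qed.

Definition isper n (w : word n) m : bool := [forall i, w (iter m (@ordS _) i) == w i].

Lemma isperP n (w : word n) m : reflect (forall k, ext w (k + m) = ext w k) (isper w m).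
Proof.
apply: (iffP forallP) => h; last by move=> i; rewrite ext_iter h ext_ord.
move=> k; have hk : (k %% n.+1 < n.+1)%N by rewrite ltn_mod.
have /eqP := h (Ordinal hk); rewrite ext_iter -ext_ord /=.
by rewrite ext_modD ext_mod.
Qed.

Lemma isper_full n (w : word n) : isper w n.+1.
Proof. by apply/forallP => i; rewrite iter_ordS_id. Qed.

Lemma isper_mul n (w : word n) m c k : isper w m -> ext w (k + c * m) = ext w k.
Proof.
move=> /isperP h; elim: c => [|c IH]; first by rewrite mul0n addn0.
by rewrite mulSn addnCA addnC h IH.
Qed.

Lemma isper_ext n (w : word n) m k : isper w m -> ext w (k %% m) = ext w k.
Proof. by move=> h; rewrite {2}(divn_eq k m) addnC isper_mul. Qed.

Lemma primitiveE n (w : word n) :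
  primitive w = [forall p : 'I_n.+1, (0 < p)%N ==> ~~ isper w p].
Proof. by apply: eq_forallb => p; rewrite negb_forall. Qed.

(** The least period is [(period w).+1]: ordinals are shifted to run over 1, ..., n + 1. *)
Definition period n (w : word n) : 'I_n.+1 :=
  [arg min_(m < (ord_max : 'I_n.+1) | isper w m.+1) m].

Lemma periodP n (w : word n) (m : 'I_n.+1) : reflect
  (isper w m.+1 /\ forall p, (p < m)%N -> ~~ isper w p.+1) (period w == m).
Proof.
rewrite /period; case: arg_minnP => /= [|m0 h1 h2]; first exact: isper_full.
apply: (iffP eqP) => [<-|[h3 h4]].
  split=> // p hp; apply/negP => h.
  have hpn : (p < n.+1)%N by apply: ltn_trans hp _.
  by have := h2 (Ordinal hpn) h; rewrite leqNgt /= hp.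
apply: ord_inj; apply/eqP; rewrite eqn_leq h2 //= leqNgt; apply/negP => h.
by have := h4 _ h; rewrite h1.
Qed.

Lemma period_dvd n (w : word n) : ((period w).+1 %| n.+1)%N.
Proof.
have /periodP[h1 h2] := eqxx (period w); set m := period w in h1 h2 *.
rewrite /dvdn -leqn0 leqNgt; apply/negP => h0.
(* A nonzero remainder of n + 1 by the least period would be a smaller period. *)
have hr : ((n.+1 %% m.+1).-1 < m)%N by rewrite -ltnS prednK // ltn_mod.
have := h2 _ hr; rewrite prednK // => /negP; apply; apply/isperP => k; rewrite -[LHS](isper_mul (n.+1 %/ m.+1) _ h1).
by rewrite -addnA [(_ %% _ + _)%N]addnC -divn_eq; apply/isperP/isper_full.
Qed.

Definition rep n m (u : word m) : word n := [ffun i : 'I_n.+1 => ext u i].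

Section Rep.
Variables n m : nat.
Hypothesis mn : (m.+1 %| n.+1)%N.
Implicit Type u : word m.

Lemma ext_rep u k : ext (rep n u) k = ext u k.
Proof.
rewrite {1}/ext ffunE inordK ?ltn_mod //.
by rewrite /ext modn_dvdm.
Qed.

Lemma isper_rep u p : isper (rep n u) p = isper u p.
Proof.
by apply/isperP/isperP => h k; have := h k; rewrite !ext_rep.
Qed.

Lemma period_rep u (hm : (m < n.+1)%N) : (period (rep n u) == Ordinal hm) = primitive u.
Proof.
rewrite primitiveE; apply/periodP/forallP => [[_ h] [[|p] hp] //=|h].
  by rewrite -isper_rep; apply: h.
split=> [|p hp]; first by rewrite isper_rep isper_full.
rewrite isper_rep; have hp' : (p.+1 < m.+1)%N by [].
exact: (implyP (h (Ordinal hp'))).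
Qed.

Lemma sum_period (V : nmodType) (F : word n -> V) (hm : (m < n.+1)%N) :
  \sum_(w | period w == Ordinal hm) F w = \sum_(u : word m | primitive u) F (rep n u).
Proof.
rewrite (reindex_onto (@rep n m) (@rep m n)) => [|w /periodP[/= h _]].
  apply: eq_bigl => u; rewrite period_rep (_ : rep m (rep n u) = u) ?eqxx ?andbT //.
  by apply/ffunP => i; rewrite ffunE ext_rep ext_ord.
apply/ffunP => i; rewrite ffunE /ext ffunE inordK ?ltn_mod // isper_ext //.
by rewrite ext_ord.
Qed.

Lemma prod_rep (R : comNzRingType) (G : T -> T -> R) u :
  \prod_i G (rep n u i) (rep n u (ordS i)) =
  (\prod_i G (u i) (u (ordS i))) ^+ (n.+1 %/ m.+1).
Proof.
pose g k := G (ext u k) (ext u k.+1).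
have gp k : g (m.+1 + k)%N = g k.
  by rewrite /g -!addnS; congr (G _ _); rewrite addnC; apply/isperP/isper_full.
have -> : \prod_i G (u i) (u (ordS i)) = \prod_(i < m.+1) g i.
  by apply: eq_bigr => i _; rewrite /g ext_ord -[ordS i]/(iter 1 (@ordS _) i) ext_iter addn1.
have -> : \prod_i G (rep n u i) (rep n u (ordS i)) = \prod_(i < n.+1) g i.
  apply: eq_bigr => i _; rewrite /g -[ordS i]/(iter 1 (@ordS _) i) ext_iter.
  by rewrite ext_rep addn1 ffunE.
have gX c : \prod_(i < c * m.+1) g i = (\prod_(i < m.+1) g i) ^+ c.
  elim: c => [|c IH]; first by rewrite big_ord0.
  rewrite mulSn big_split_ord /= exprS -IH; congr (_ * _).
  by apply: eq_bigr => i _; rewrite gp.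
by rewrite -gX divnK.
Qed.

End Rep.

Lemma sum_words (V : nmodType) n (F : word n -> V) :
  \sum_w F w = \sum_(m < n.+1 | (m.+1 %| n.+1)%N) \sum_(u : word m | primitive u) F (rep n u).
Proof.
rewrite (partition_big (@period n) (fun m : 'I_n.+1 => m.+1 %| n.+1)%N) /=; last first.
  by move=> w _; apply: period_dvd.
by apply: eq_bigr => -[m hm] /= mn; rewrite sum_period.
Qed.

End Periods.

(** * The trace as a sum over primitive words *)

Section WordSum.
Variables (A : comNzRingType) (t : A).

Definition stepl M e (l l' : bool * 'I_M) : {poly A} :=
  if stepv l l' then letterw t e l else 0.

Lemma prod_stepl M n e (w : {ffun 'I_n.+1 -> bool * 'I_M}) :
  \prod_i stepl e (w i) (w (ordS i)) = if valid w then \prod_i letterw t e (w i) else 0.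
Proof.
case: ifP => hv.
  by apply: eq_bigr => i _; rewrite /stepl; have /forallP/(_ i) -> := hv.
have [i hi] : exists i, ~~ stepv (w i) (w (ordS i)).
  by apply/existsP; rewrite -negb_forall; apply: negbT hv.
by rewrite (bigD1 i) //= /stepl (negPf hi) mul0r.
Qed.

Lemma letterwX M e (l : bool * 'I_M) : letterw t 1 l ^+ e = letterw t e l.
Proof.
by rewrite /letterw exprMn -rmorphXn /= -!exprM !mul1n [(_ * e)%N]mulnC [(l.2 * e)%N]mulnC.
Qed.

(** Splitting each matrix entry by the bar gives a sum over valid words, each the repetition of a
    unique primitive word. *)
Lemma trace_transfer M n :
  \tr (transfer t%:P (fun a : 'I_M.+1 => 'X^a) ^+ n.+1) =
  \sum_(m < n.+1 | (m.+1 %| n.+1)%N)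
    \sum_(u : {ffun 'I_m.+1 -> bool * 'I_M.+1} | valid u && primitive u)
      \prod_i letterw t (n.+1 %/ m.+1) (u i).
Proof.
transitivity (\sum_(w : {ffun 'I_n.+1 -> bool * 'I_M.+1}) \prod_i stepl 1 (w i) (w (ordS i))).
  rewrite trace_words.
  rewrite (reindex (fun p : {ffun 'I_n.+1 -> 'I_M.+1} * {ffun 'I_n.+1 -> bool} =>
     [ffun i => (p.2 i, p.1 i)])) /=; last first.
    exists (fun w : {ffun 'I_n.+1 -> bool * 'I_M.+1} =>
       ([ffun i => (w i).2], [ffun i => (w i).1])).
      by move=> [a b] _ /=; congr (_, _); apply/ffunP => i; rewrite !ffunE.
    by move=> w _ /=; apply/ffunP => i; rewrite !ffunE /=; case: (w i).
  rewrite -(pair_bigA _ (fun (a : {ffun 'I_n.+1 -> 'I_M.+1}) (b : {ffun 'I_n.+1 -> bool}) =>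
     \prod_i stepl 1 ([ffun i => (b i, a i)] i)
     ([ffun i => (b i, a i)] (ordS i)))) /=.
  apply: eq_bigr => a _.
  (* The bar of the following letter does not affect [stepl]; [false] stands in for it. *)
  pose G i (c : bool) := stepl 1 (c, a i) (false, a (ordS i)).
  transitivity (\prod_i \sum_c G i c).
    apply: eq_bigr => i _; rewrite mxE big_bool /G /stepl /stepv /letterw /stepw /=.
    by case: ltngtP => _; rewrite ?muln1 ?mul1n ?muln0 ?expr0 ?expr1 ?polyC1; ring.
  rewrite bigA_distr_bigA; apply: eq_bigr => b _; apply: eq_bigr => i _.
  by rewrite !ffunE.
rewrite sum_words; apply: eq_bigr => m mn; rewrite [RHS]big_mkcondl /=.
apply: eq_bigr => u _; rewrite prod_rep // prod_stepl; case: ifP => _.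
  by rewrite -prodrXl; apply: eq_bigr => i _; rewrite letterwX.
(* An invalid word contributes a power of 0 with positive exponent. *)
by rewrite expr0n gtn_eqF // divn_gt0 // dvdn_leq.
Qed.

End WordSum.

(** * Coefficients of the finite product E(z) *)

Section Beta.
Variable A : comNzRingType.

(* [beta n]`_j is (-1)^j q^(j(j-1)/2) times a Gaussian binomial coefficient. *)
Definition beta n : {poly {poly A}} := esgn (fun i : 'I_n => 'X^i).

Lemma beta_coef0 n : (beta n)`_0 = 1.
Proof.
by apply: coef0_prod_1 => i _; rewrite coefB coef1 coefCM coefX mulr0 subr0.
Qed.

(** Compare coefficients in (1 - z) E(qz) = E(z) (1 - q^n z). *)
Lemma beta_rec n j : (beta n)`_(j.+1) * (1 - 'X^(j.+1)) = ('X^n - 'X^j) * (beta n)`_j.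
Proof.
have h : (1 - 'X) * esgn (fun i : 'I_n => 'X * 'X^i) = beta n * (1 - ('X^n)%:P * 'X)
    :> {poly {poly A}}.
  rewrite /beta /esgn -(big_ord_recr n (fun i => 1 - ('X^i)%:P * 'X)) big_ord_recl /=.
  rewrite expr0 polyC1 mul1r; congr (_ * _); apply: eq_bigr => i _.
  by rewrite -exprS.
have := congr1 (fun p : {poly {poly A}} => p`_(j.+1)) h.
rewrite mulrBl mul1r mulrBr mulr1 !coefB coefXM /= !coef_esgn_scale.
rewrite mulrCA coefCM coefMX /= -/(beta n) => h'.
move: h'; move: (beta n)`_(j.+1) (beta n)`_j => x y h'.
have -> : x * (1 - 'X^(j.+1)) = (x - 'X^n * y) - ('X^(j.+1) * x - 'X^j * y) +
  ('X^n - 'X^j) * y by ring.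
by rewrite h' subrr add0r.
Qed.
(** Modulo q^M, the coefficient for M letters is (-1)^j q^(j(j-1)/2) / (q; q)_j, and (q; q)_n / (q;
    q)_j is a Gaussian binomial times (q; q)_(n-j). *)
Lemma eqm_qpoch_beta M n j : (j <= n)%N ->
  eqm M (qpoch A 1 n * (beta M)`_j) ((beta n)`_j * qpoch A 1 (n - j)).
Proof.
elim: j => [|j IH] hj; first by rewrite !beta_coef0 mulr1 mul1r subn0.
apply: (@eqm_cancel _ _ (1 - 'X^(j.+1))).
  by rewrite coefB coef1 coefXn subr0.
have -> : (1 - 'X^(j.+1)) * (qpoch A 1 n * (beta M)`_(j.+1)) =
    'X^M * (qpoch A 1 n * (beta M)`_j) - 'X^j * (qpoch A 1 n * (beta M)`_j).
  by rewrite mulrCA [_ * (beta M)`_ _]mulrC beta_rec; ring.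
have -> : (1 - 'X^(j.+1)) * ((beta n)`_(j.+1) * qpoch A 1 (n - j.+1)) =
    0 * (qpoch A 1 n * (beta M)`_j) - 'X^j * ((beta n)`_j * qpoch A 1 (n - j)).
  rewrite [(1 - _) * (_ * _)]mulrA [(1 - _) * _]mulrC beta_rec mul0r add0r.
  rewrite (_ : n - j = (n - j.+1).+1)%N; last lia.
  rewrite qpochS mul1n (_ : (n - j.+1).+1 = n - j)%N; last lia.
  have -> : 'X^n = 'X^j * 'X^(n - j) :> {poly A} by rewrite -exprD subnKC // ltnW.
  by ring.
apply: eqmD; first by apply: eqmM => //; apply: eqm_Xn0.
by apply/eqmN/eqmMl/IH; apply: ltnW.
Qed.

Lemma size_beta n : (size (beta n) <= n.+1)%N.
Proof.
rewrite /beta /esgn; elim: n => [|n IH]; first by rewrite big_ord0 size_poly1.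
rewrite big_ord_recr /= mulrBr mulr1.
apply: leq_trans (size_polyD _ _) _; rewrite geq_max size_polyN; apply/andP; split.
  exact: leqW IH.
rewrite mulrA; apply: leq_trans (size_polyMleq _ _) _; rewrite size_polyX addn2 /=.
rewrite ltnS; apply: leq_trans IH; rewrite mulrC.
by rewrite mul_polyC size_scale_leq.
Qed.

End Beta.

(** * Normalised word sums and their recurrence *)

Section NormalisedWords.
Variables (A : comNzRingType) (t : A).

(** For e > 0 this is (q; q)_(em) / (q^e; q^e)_m. *)
Definition cofac e m : {poly A} :=
  \prod_(l < m) \prod_(j < e.-1) (1 - 'X^(e * l + j.+1)).

(** One-letter words fall outside the bijection: they admit both bars, while the 1-cycle has no
    excedance. *)
Definition primpoly m e : {poly A} :=
  if m == 0%N then (1 + t ^+ e)%:P else cyclepoly m t e *+ m.+1.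

(** This is (q; q)_n W_n as a polynomial free of the alphabet size; [m.+1] is the least period. *)
Definition wordpoly n : {poly A} :=
  \sum_(m < n | (m.+1 %| n)%N) cofac (n %/ m.+1) m.+1 * primpoly m (n %/ m.+1).

Lemma eqm_primpoly M m e : (0 < e)%N ->
  eqm M (qpoch A e m.+1 *
    \sum_(u : {ffun 'I_m.+1 -> bool * 'I_M} | valid u && primitive u) \prod_i letterw t e (u i))
    (primpoly m e).
Proof.
move=> e0; rewrite /primpoly; case: m => [|m] /=; last exact: eqm_primitive.
have -> : \sum_(u : {ffun 'I_1 -> bool * 'I_M} | valid u && primitive u)
    \prod_i letterw t e (u i) = (1 + t ^+ e)%:P * \sum_(a < M) (if (0 <= a)%N then 'X^(e * a) else 0).
  rewrite (eq_bigl predT) => [|u]; last first.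
    apply/andP; split; last by apply/forallP => -[[]].
    apply/forallP => i; rewrite /stepv (_ : ordS i = i); last by rewrite [LHS]ord1 [RHS]ord1.
    by case: ifP.
  rewrite sum_snoc (eq_bigr (letterw t e)) => [|l _]; last first.
    rewrite (big_pred1 (ffun0 (card_ord 0))); last by move=> s /=; apply/esym/eqP/ffunP => -[].
    by rewrite big_ord1 (_ : ord0 = ord_max) ?snoc_max //; apply: val_inj.
  transitivity (\sum_(b : bool) \sum_(a < M) letterw t e (b, a)).
    by rewrite pair_bigA; apply: eq_bigr => -[].
  rewrite big_bool /= -big_split /= big_distrr; apply: eq_bigr => a _.
  by rewrite /letterw /= muln1 muln0 expr0 rmorphD /= polyC1; ring.
rewrite qpochS /qpoch big_ord0 mul1r muln1 mulrCA.
rewrite -[X in eqm _ _ X]mulr1; apply: eqmMl.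
by have := @eqm_geometric A M e 0 e0; rewrite muln0 expr0.
Qed.

Lemma eqm_wordpoly M n :
  eqm M.+1 (qpoch A 1 n.+1 * \tr (transfer t%:P (fun a : 'I_M.+1 => 'X^a) ^+ n.+1))
    (wordpoly n.+1).
Proof.
rewrite trace_transfer big_distrr /=; apply: eqm_sum => m mn.
have e0 : (0 < n.+1 %/ m.+1)%N by rewrite divn_gt0 // dvdn_leq.
set e := (n.+1 %/ m.+1)%N in e0 *.
have -> : qpoch A 1 n.+1 = cofac e m.+1 * qpoch A e m.+1.
  by rewrite mulrC /cofac -[in LHS](divnK mn) -/e -(prednK e0) /= -qpoch_mul.
by rewrite -mulrA; apply: eqmMl; apply: eqm_primpoly.
Qed.

(** Newton's identities times (q; q)_n: by [eqm_qpoch_beta] a factor (q; q)_(n-j) is left to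
    normalise each trace. Agreement modulo every power of q is equality. *)
Lemma wordpoly_rec n : GRing.lreg (1 - t%:P : {poly A}) ->
  \sum_(j < n) qint j.+1 t%:P * (beta A n)`_j * wordpoly (n - j) =
  - (n%:R * qint n.+1 t%:P * (beta A n)`_n).
Proof.
move=> t1; apply: eqm_eq => M.
pose tr k := \tr (transfer t%:P (fun a : 'I_M.+1 => 'X^a) ^+ k).
apply: (@eqm_trans _ _ _ (qpoch A 1 n * \sum_(j < n) qint j.+1 t%:P * (beta A M.+1)`_j * tr (n - j)%N)).
  apply: eqm_sym; rewrite big_distrr /=; apply: eqm_sum => j _.
  have hj := ltn_ord j.
  apply: (@eqm_trans _ _ _ (qint j.+1 t%:P * ((beta A n)`_j * qpoch A 1 (n - j) * tr (n - j)%N))).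
    rewrite [X in eqm _ X](_ : _ =
      qint j.+1 t%:P * (qpoch A 1 n * (beta A M.+1)`_j * tr (n - j)%N)); last ring.
    by apply/eqmMl/eqmM => //; apply: eqm_qpoch_beta; apply: ltnW.
  rewrite [X in eqm _ _ X](_ : _ = qint j.+1 t%:P * ((beta A n)`_j * wordpoly (n - j))); last by ring.
  apply: eqmMl; rewrite -mulrA; apply: eqmMl; rewrite /tr.
  by rewrite (_ : n - j = (n - j).-1.+1)%N; [apply: eqm_wordpoly | lia].
rewrite newton_transfer // mulrN; apply: eqmN.
have := @eqm_qpoch_beta A M.+1 n n (leqnn n); rewrite subnn /qpoch big_ord0 mulr1 => h.
by rewrite mulrCA; apply: eqmMl.
Qed.

End NormalisedWords.

(** * Eulerian polynomials *)

Section Eulerian.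

(** The new maximum enters the cycle notation right after [p.1], or as a fixed point if [p.1] is
    [ord_max]. *)
Definition insert_max k (p : 'I_k.+1 * 'S_k) : 'S_k.+1 :=
  (tperm p.1 ord_max * lift_perm ord_max ord_max p.2)%g.

Lemma insert_max_bij k : bijective (@insert_max k).
Proof.
apply: inj_card_bij; last first.
  by rewrite card_prod card_ord !card_Sn factS.
move=> [j s] [j' s'] /permP h.
have hj : j = j'.
  have := h j; rewrite /insert_max !permM /= tpermL lift_perm_id.
  rewrite -[LHS](lift_perm_id ord_max ord_max s') => /perm_inj e.
  by rewrite -(tpermK j' ord_max j) -e tpermR.
congr (_, _) => //; apply/permP => x; subst j'.
have := h (tperm j ord_max (lift ord_max x)).
by rewrite /insert_max !permM /= !tpermK !lift_perm_lift => /lift_inj.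
Qed.

Lemma exc_insert_max k (s : 'S_k) : exc (insert_max (ord_max, s)) = exc s.
Proof.
rewrite !excE big_ord_recr /= /exc_at /insert_max tperm1 mul1g lift_perm_id ltnn addn0.
apply: eq_bigr => x _.
rewrite (_ : widen_ord _ x = lift ord_max x); last by apply: val_inj; rewrite [RHS]lift_max.
by rewrite lift_perm_lift !lift_max.
Qed.

Lemma exc_insert_lift k (s : 'S_k) (j : 'I_k) :
  exc (insert_max (lift ord_max j, s)) = (exc s + ~~ exc_at s j)%N.
Proof.
rewrite !excE big_ord_recr /= /exc_at /insert_max !permM /= tpermR lift_perm_lift.
rewrite lift_max [X in (_ + X)%N](_ : _ = 0%N); last by rewrite ltnNge ltnW.
rewrite addn0 (bigD1 j) //= [in RHS](bigD1 j) //= addnAC.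
rewrite (_ : widen_ord _ j = lift ord_max j); last by apply: val_inj; rewrite [RHS]lift_max.
rewrite permM tpermL lift_perm_id ?lift_max /= ltn_ord; congr (_ + _)%N; first by case: ltnP.
apply: eq_bigr => x hx.
rewrite (_ : widen_ord _ x = lift ord_max x); last by apply: val_inj; rewrite [RHS]lift_max.
rewrite permM tpermD ?lift_perm_lift ?lift_max ?neq_lift //.
by rewrite (inj_eq lift_inj) eq_sym.
Qed.

Variable C : comNzRingType.
Notation E k := (eulerian k ('X : {poly C})).

Lemma eulerian0 : E 0 = 1.
Proof.
rewrite /eulerian (eq_bigr (fun=> 1)) => [|s _]; last first.
  by rewrite excE big_ord0.
by rewrite sumr_const card_Sn.
Qed.

(** Insertion as a fixed point or after an excedance preserves exc; the other k - exc s places add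
    one. The derivative records exc s. *)
Lemma eulerianS k : E k.+1 = (1 + k%:R * 'X) * E k + 'X * (1 - 'X) * (E k)^`().
Proof.
rewrite /eulerian (reindex (@insert_max k)) /=; last first.
  by apply: onW_bij; apply: insert_max_bij.
rewrite -(pair_bigA _ (fun j s => 'X ^+ exc (insert_max (j, s)))) /= exchange_big /=.
rewrite (raddf_sum (@deriv C)) !big_distrr /= -big_split /=; apply: eq_bigr => s _.
rewrite (bigD1_ord ord_max) //= exc_insert_max.
under eq_bigr => j _ do rewrite exc_insert_lift exprD.
rewrite -big_distrr /=.
have -> : \sum_(j < k) 'X ^+ (~~ exc_at s j) = (exc s)%:R + (k%:R - (exc s)%:R) * 'X :> {poly C}.
  have -> : k%:R = \sum_(j < k) 1 :> {poly C} by rewrite sumr_const card_ord.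
  rewrite excE natr_sum -sumrB big_distrl -big_split /=.
  by apply: eq_bigr => j _; case: (exc_at s j) => /=; rewrite ?expr0 ?expr1; ring.
rewrite derivXn -mulr_natr; case: (exc s) => [|e] /=; first by rewrite expr0; ring.
rewrite exprS; ring.
Qed.

(* Multiplying the exponential generating function by e^((t-1)u); both sides of the
   induction step satisfy the recurrence [eulerianS]. *)
Lemma eulerian_binomial k :
  \sum_(i < k.+1) 'C(k, i)%:R * ('X - 1) ^+ i * E (k - i) =
  'X * E k + (1 - 'X) *+ (k == 0%N).
Proof.
pose B k := \sum_(i < k.+1) 'C(k, i)%:R * ('X - 1) ^+ i * E (k - i).
rewrite -/(B k).
have B0 : B 0%N = 1 by rewrite /B big_ord1 bin0 expr0 mul1r mul1r eulerian0.
(* Pascal's rule splits [B m.+1] into ('X - 1) B m and a sum over E (m - i).+1, to which [eulerianS]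
   applies. *)
have BS m : B m.+1 = ('X - 1) * B m + (1 + m%:R * 'X) * B m + 'X * (1 - 'X) * (B m)^`().
  have -> : B m.+1 = \sum_(i < m.+1) 'C(m, i)%:R * ('X - 1) ^+ i * E (m - i).+1 +
      ('X - 1) * B m.
    rewrite /B big_ord_recl /= bin0 expr0 subn0.
    under eq_bigr => i _ do
      rewrite /bump /= add1n binS natrD 2!mulrDl subSS exprS.
    rewrite big_split /= addrA; congr (_ + _); last first.
      by rewrite big_distrr /=; apply: eq_bigr => i _; ring.
    rewrite [in RHS]big_ord_recl /= bin0 expr0 subn0; congr (_ + _).
    rewrite big_ord_recr /= bin_small // !mul0r addr0.
    apply: eq_bigr => i _; rewrite /bump /= add1n exprS; congr (_ * _ * E _).
    by have := ltn_ord i; lia.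
  rewrite addrC -addrA; congr (_ + _).
  rewrite /B (raddf_sum (@deriv C)) !big_distrr /= -big_split /=; apply: eq_bigr => i _.
  have hi : m%:R = (m - i)%:R + i%:R :> {poly C} by rewrite -natrD subnK // -ltnS.
  rewrite eulerianS hi derivM derivM -polyC_natr derivC mul0r add0r deriv_exp.
  rewrite derivB derivX -polyC1 derivC subr0 polyC1 mul1r -mulr_natr.
  case: (nat_of_ord i) => [|l] /=; first by rewrite expr0; ring.
  by rewrite exprS; ring.
elim: k => [|k IH]; first by rewrite B0 eulerian0 /= mulr1n; ring.
rewrite BS IH eulerianS; case: k {IH} => [|k] /=.
  rewrite eulerian0 derivD derivM derivX -polyC1 derivC derivB derivX derivC; ring.
rewrite derivD derivM derivX mulr0n -polyC0 derivC polyC0; ring.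
Qed.

End Eulerian.

(** * Binomial sums through a linear functional *)

Section Umbral.
Variables (A : comNzRingType) (a : nat -> A).

(** The linear functional sending ['X^i] to a i. *)
Definition umbral (p : {poly A}) : A := \sum_(i < size p) p`_i * a i.

Lemma umbral_wide N (p : {poly A}) : (size p <= N)%N -> umbral p = \sum_(i < N) p`_i * a i.
Proof.
move=> h; rewrite /umbral (big_ord_widen N (fun i => p`_i * a i) h) big_mkcond /=.
by apply: eq_bigr => i _; case: ltnP => // hi; rewrite nth_default ?mul0r.
Qed.

Lemma umbral_linear : linear_for *%R umbral.
Proof.
move=> c p q; pose N := maxn (size (c *: p + q)) (maxn (size p) (size q)).
rewrite !(@umbral_wide N) ?leq_maxl // /N; try lia.
rewrite big_distrr -big_split /=; apply: eq_bigr => i _.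
by rewrite coefD coefZ; ring.
Qed.

HB.instance Definition _ := GRing.isLinear.Build A {poly A} A *%R umbral umbral_linear.

Lemma umbralXn k : umbral 'X^k = a k.
Proof.
rewrite /umbral size_polyXn big_ord_recr /= big1 ?add0r ?coefXn ?eqxx ?mul1r //.
by move=> i _; rewrite coefXn ltn_eqF ?mul0r.
Qed.

Lemma umbral_binomial (y : A) K :
  umbral (('X + y%:P) ^+ K) = \sum_(i < K.+1) 'C(K, i)%:R * y ^+ i * a (K - i).
Proof.
rewrite exprDn linear_sum /=; apply: eq_bigr => i _.
rewrite linearMn /= -rmorphXn /= mulrC mul_polyC linearZ /= umbralXn -mulr_natl; ring.
Qed.

Lemma umbralX_binomial (y : A) K :
  umbral ('X * ('X + y%:P) ^+ K) = \sum_(i < K.+1) 'C(K, i)%:R * y ^+ i * a (K - i).+1.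
Proof.
rewrite exprDn big_distrr linear_sum /=; apply: eq_bigr => i _.
rewrite mulrnAr mulrA -exprS linearMn /= -rmorphXn /= mulrC mul_polyC linearZ /= umbralXn.
by rewrite -mulr_natl; ring.
Qed.

End Umbral.

(** * Solving the recurrence, with a k = A_k(t) [d]_t^k in view *)

Section Recurrence.
Variables (A : comNzRingType) (t : A) (d : nat) (a : nat -> A).
Hypothesis t1 : GRing.lreg (1 - t).
Let T := t ^+ d.
Let D := qint d t.
Hypothesis a0 : a 0%N = 1.
Hypothesis a_binomial : forall k,
  \sum_(i < k.+1) 'C(k, i)%:R * (T - 1) ^+ i * a (k - i) = t * a k + (1 - t) *+ (k == 0%N).

(** The case p = ['X^k] is [a_binomial]; both sides are linear in p. *)
Lemma umbral_shift (p : {poly A}) : umbral a (p \Po ('X + (T - 1)%:P)) = t * umbral a p + (1 - t) * p`_0.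
Proof.
rewrite -[p]coefK poly_def raddf_sum !linear_sum /= coef_sum !big_distrr /= -big_split /=.
apply: eq_bigr => i _; rewrite linearZ /= comp_Xn_poly linearZ /= umbral_binomial a_binomial.
rewrite linearZ /= umbralXn coefZ coefXn eq_sym mulr_natr -mulr_natr; ring.
Qed.

Lemma qintM i : (1 - t) * qint (d * i).+1 t = 1 - t * T ^+ i.
Proof. by rewrite qintE exprS exprM. Qed.

Lemma qintM2 i : (1 - t) * qint (d * i).+2 t = 1 - t ^+ 2 * T ^+ i.
Proof. by rewrite qintE !exprS expr0 exprM mulr1 mulrA. Qed.

(** The shift by T - 1 carries (X - T)^K to (X - 1)^K. *)
Lemma umbral_shift_binomial K :
  umbral a (('X + (-1)%:P) ^+ K) =
  t * umbral a (('X + (- T)%:P) ^+ K) + (1 - t) * (- T) ^+ K.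
Proof.
have := umbral_shift (('X + (- T)%:P) ^+ K).
rewrite rmorphXn /= comp_polyD comp_polyX comp_polyC -addrA -rmorphD /=.
have -> : T - 1 - T = -1 by ring.
by move=> ->; rewrite -horner_coef0 horner_exp !hornerE.
Qed.

Lemma umbralX_shift_binomial K :
  umbral a ('X * ('X + (-1)%:P) ^+ K) + (T - 1) * umbral a (('X + (-1)%:P) ^+ K) =
  t * umbral a ('X * ('X + (- T)%:P) ^+ K).
Proof.
have := umbral_shift ('X * ('X + (- T)%:P) ^+ K).
rewrite rmorphM rmorphXn /= comp_polyD comp_polyX comp_polyC -addrA -rmorphD /=.
have -> : T - 1 - T = -1 by ring.
rewrite coefXM /= mulr0 addr0 => <-.
by rewrite [in RHS]mulrDl linearD /= mul_polyC linearZ.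
Qed.

(** As (1 - t) [di + 1]_t = 1 - t T^i, the sum times 1 - t is U((X - 1)^K) - t U((X - T)^K) with U =
    [umbral a]. *)
Lemma sum_qint_a K :
  \sum_(i < K.+1) (-1) ^+ i * 'C(K, i)%:R * qint (d * i).+1 t * a (K - i) = (- T) ^+ K.
Proof.
apply: t1; have := umbral_shift_binomial K.
rewrite !umbral_binomial => /(canLR (addKr _)) <-.
rewrite !big_distrr -sumrN -big_split /=; apply: eq_bigr => i _.
have -> : (1 - t) * ((-1) ^+ i * 'C(K, i)%:R * qint (d * i).+1 t * a (K - i)) =
   (-1) ^+ i * 'C(K, i)%:R * a (K - i) * ((1 - t) * qint (d * i).+1 t) by ring.
by rewrite qintM [(- T) ^+ i]exprNn; ring.
Qed.

Lemma sum_qint_a2 K :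
  \sum_(i < K.+1) (-1) ^+ i * 'C(K, i)%:R *
    (qint (d * i).+1 t * a (K - i).+1 - D * qint (d * i).+2 t * a (K - i)) =
  - ((- T) ^+ K * t * D).
Proof.
apply: t1; have h1 := umbral_shift_binomial K; have h2 := umbralX_shift_binomial K.
have hD : (1 - t) * D = 1 - T by rewrite qintE.
have -> : (1 - t) * - ((- T) ^+ K * t * D) =
    umbral a ('X * ('X + (-1)%:P) ^+ K) - t * umbral a ('X * ('X + (- T)%:P) ^+ K)
    - D * umbral a (('X + (-1)%:P) ^+ K) + D * (t ^+ 2 * umbral a (('X + (- T)%:P) ^+ K)).
  rewrite -h2 h1.
  have -> : T = 1 - (1 - t) * D by rewrite hD; ring.
  move: (umbral _ _) (umbral _ _) ((- _) ^+ K) => u v w; ring.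
rewrite !umbral_binomial !umbralX_binomial !big_distrr -!sumrN -!big_split /=.
apply: eq_bigr => i _; rewrite [(- T) ^+ i]exprNn.
set x := qint (d * i).+1 t; set y := qint (d * i).+2 t.
have -> : (1 - t) * ((-1) ^+ i * 'C(K, i)%:R * (x * a (K - i).+1 - D * y * a (K - i))) =
   (-1) ^+ i * 'C(K, i)%:R * (((1 - t) * x) * a (K - i).+1 - D * ((1 - t) * y) * a (K - i)) by ring.
by rewrite /x /y qintM qintM2; ring.
Qed.

(* The values at the root of unity of the normalised word sums of lengths dk and dk+1. *)
Definition val_dk k : A := (d * k)%:R * t * D * a k.-1 + d%:R *+ (k == 1%N).
Definition val_dk1 k : A := (d * k).+1%:R * t * a k + (k == 0%N)%:R.

Lemma bin_natr k i : (i < k.+1)%N ->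
  'C(k.+1, i)%:R * (k.+1 - i)%:R = k.+1%:R * 'C(k, i)%:R :> A.
Proof. by move=> hi; rewrite -!natrM mulnC -mul_bin_down. Qed.

Lemma sum_last (k : nat) (F : nat -> A) :
  \sum_(i < k.+1) F i *+ (k.+1 - i == 1)%N = F k.
Proof.
rewrite big_ord_recr /= subSn // subnn eqxx big1 ?add0r // => i _.
by case: eqP => // h; have := ltn_ord i; lia.
Qed.

Lemma qint_dS k : qint (d * k.+1).+1 t = qint (d * k).+1 t + t * T ^+ k * D.
Proof.
apply: t1; rewrite mulrDr !qintM.
have -> : (1 - t) * (t * T ^+ k * D) = t * T ^+ k * ((1 - t) * D) by ring.
by rewrite qintE -/T [T ^+ k.+1]exprS; ring.
Qed.

Lemma qint_dS2 k : qint (d * k.+1).+2 t = qint (d * k).+2 t + t ^+ 2 * T ^+ k * D.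
Proof.
apply: t1; rewrite mulrDr !qintM2.
have -> : (1 - t) * (t ^+ 2 * T ^+ k * D) = t ^+ 2 * T ^+ k * ((1 - t) * D) by ring.
by rewrite qintE -/T [T ^+ k.+1]exprS; ring.
Qed.

(** The absorption identity [bin_natr] reduces the sum to [sum_qint_a]; the exceptional value at 1
    enters only the last term. *)
Lemma val_dk_rec k :
  \sum_(i < k) (-1) ^+ i * 'C(k, i)%:R * qint (d * i).+1 t * val_dk (k - i) =
  - ((-1) ^+ k * (d * k)%:R * qint (d * k).+1 t).
Proof.
case: k => [|k]; first by rewrite big_ord0 muln0; ring.
rewrite (eq_bigr (fun i : 'I_k.+1 =>
   (d * k.+1)%:R * t * D * ((-1) ^+ i * 'C(k, i)%:R * qint (d * i).+1 t * a (k - i)) +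
   ((-1) ^+ i * (d * 'C(k.+1, i))%:R * qint (d * i).+1 t) *+ (k.+1 - i == 1)%N)); last first.
  move=> i _; rewrite /val_dk -subnS subSS !natrM.
  have := @bin_natr k i (ltn_ord i); move: 'C(k.+1, i)%:R (k.+1 - i)%:R => x y h.
  transitivity (d%:R * (x * y) * t * D * ((-1) ^+ i * qint (d * i).+1 t * a (k - i)) +
    (-1) ^+ i * (d%:R * x) * qint (d * i).+1 t *+ (k.+1 - i == 1)%N); last by rewrite h; ring.
  by case: (_ == _); rewrite ?mulr1n ?mulr0n; ring.
rewrite big_split /= -big_distrr /= sum_qint_a.
rewrite (sum_last k (fun i => (-1) ^+ i * (d * 'C(k.+1, i))%:R * qint (d * i).+1 t)).
rewrite qint_dS binSn [(- T) ^+ k]exprNn exprS; ring.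
Qed.

(** After absorption the two sums combine into [sum_qint_a2]; the exceptional values at 0 and 1
    enter only last terms. *)
Lemma val_dk1_rec k :
  \sum_(i < k.+1) (-1) ^+ i * 'C(k, i)%:R * qint (d * i).+1 t * val_dk1 (k - i) -
  \sum_(i < k) (-1) ^+ i * 'C(k, i)%:R * qint (d * i).+2 t * val_dk (k - i) =
  (-1) ^+ k * (d * k).+1%:R * qint (d * k).+2 t.
Proof.
case: k => [|k].
  rewrite big_ord1 big_ord0 /val_dk1 /qint !muln0 /= !big_ord_recr !big_ord0 /= a0 bin0; ring.
have e1 : \sum_(i < k.+2) (-1) ^+ i * 'C(k.+1, i)%:R * qint (d * i).+1 t * val_dk1 (k.+1 - i) =
    t * (- T) ^+ k.+1 + (-1) ^+ k.+1 * qint (d * k.+1).+1 t +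
    (d * k.+1)%:R * t * \sum_(i < k.+1) (-1) ^+ i * 'C(k, i)%:R * qint (d * i).+1 t * a (k - i).+1.
  rewrite (eq_bigr (fun i : 'I_k.+2 =>
     t * ((-1) ^+ i * 'C(k.+1, i)%:R * qint (d * i).+1 t * a (k.+1 - i)) +
     d%:R * t * ((-1) ^+ i * ('C(k.+1, i)%:R * (k.+1 - i)%:R) * qint (d * i).+1 t * a (k.+1 - i)) +
     (-1) ^+ i * 'C(k.+1, i)%:R * qint (d * i).+1 t * (k.+1 - i == 0)%N%:R)); last first.
    by move=> i _; rewrite /val_dk1 -natr1 natrM; ring.
  rewrite !big_split /= -!big_distrr /= sum_qint_a addrAC; congr (_ + _ + _).
    rewrite big_ord_recr /= subnn binn big1 ?add0r ?mulr1 // => i _.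
    by rewrite subn_eq0 leqNgt ltn_ord mulr0.
  rewrite big_ord_recr /= subnn !mulr0 !mul0r addr0 natrM !big_distrr /=.
  apply: eq_bigr => i _; rewrite bin_natr // subSn -1?ltnS //; ring.
have e2 : \sum_(i < k.+1) (-1) ^+ i * 'C(k.+1, i)%:R * qint (d * i).+2 t * val_dk (k.+1 - i) =
    (d * k.+1)%:R * t * \sum_(i < k.+1) (-1) ^+ i * 'C(k, i)%:R * (D * qint (d * i).+2 t * a (k - i)) +
    (-1) ^+ k * (d * k.+1)%:R * qint (d * k).+2 t.
  rewrite (eq_bigr (fun i : 'I_k.+1 =>
     (d * k.+1)%:R * t * ((-1) ^+ i * 'C(k, i)%:R * (D * qint (d * i).+2 t * a (k - i))) +
     ((-1) ^+ i * (d * 'C(k.+1, i))%:R * qint (d * i).+2 t) *+ (k.+1 - i == 1)%N)); last first.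
    move=> i _; rewrite /val_dk -subnS subSS !natrM.
    have := @bin_natr k i (ltn_ord i); move: 'C(k.+1, i)%:R (k.+1 - i)%:R => x y h.
    transitivity (d%:R * (x * y) * t * D * ((-1) ^+ i * qint (d * i).+2 t * a (k - i)) +
      (-1) ^+ i * (d%:R * x) * qint (d * i).+2 t *+ (k.+1 - i == 1)%N); last by rewrite h; ring.
    by case: (_ == _); rewrite ?mulr1n ?mulr0n; ring.
  rewrite big_split /= -big_distrr /=; congr (_ + _).
  by rewrite (sum_last k (fun i => (-1) ^+ i * (d * 'C(k.+1, i))%:R * qint (d * i).+2 t)) binSn.
have e3 := sum_qint_a2 k.
have e4 : \sum_(i < k.+1) (-1) ^+ i * 'C(k, i)%:R * qint (d * i).+1 t * a (k - i).+1 =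
    \sum_(i < k.+1) (-1) ^+ i * 'C(k, i)%:R * (D * qint (d * i).+2 t * a (k - i)) -
    (- T) ^+ k * t * D.
  by rewrite -e3 -big_split /=; apply: eq_bigr => i _; ring.
rewrite e1 e2 e4 -natr1 2!mulrDr mulr1 mulrDl.
have -> : (-1) ^+ k.+1 * (d * k.+1)%:R * qint (d * k.+1).+2 t =
  (-1) ^+ k.+1 * (d * k.+1)%:R * (qint (d * k).+2 t + t ^+ 2 * T ^+ k * D) by rewrite qint_dS2.
have -> : qint (d * k.+1).+2 t = qint (d * k.+1).+1 t + t * T ^+ k.+1.
  by rewrite {1}/qint big_ord_recr /= exprS exprM.
rewrite ![(- T) ^+ _]exprNn ![(-1) ^+ k.+1]exprS; ring.
Qed.

Lemma qint1 : qint 1 t = 1.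
Proof. by rewrite /qint big_ord1. Qed.

Lemma umbral_binom_Xd (f : nat -> A) k :
  umbral f ((1 - 'X^d) ^+ k) = \sum_(i < k.+1) (-1) ^+ i * 'C(k, i)%:R * f (d * i)%N.
Proof.
rewrite exprBn linear_sum; apply: eq_bigr => i _.
rewrite expr1n mulr1 -exprM -(rmorph_sign (@polyC A)) /= linearMn /= mul_polyC linearZ /= umbralXn.
by rewrite -mulr_natl; ring.
Qed.

Lemma umbral_binom_Xd1 (f : nat -> A) k :
  umbral f ((1 - 'X^d) ^+ k * (1 - 'X)) =
  \sum_(i < k.+1) (-1) ^+ i * 'C(k, i)%:R * f (d * i)%N -
  \sum_(i < k.+1) (-1) ^+ i * 'C(k, i)%:R * f (d * i).+1.
Proof.
rewrite mulrBr mulr1 linearB /= umbral_binom_Xd; congr (_ - _).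
rewrite exprBn big_distrl linear_sum /=; apply: eq_bigr => i _.
rewrite expr1n mulr1 -exprM -(rmorph_sign (@polyC A)) /= mulrnAl -[_ * 'X^_ * 'X]mulrA -exprSr.
rewrite linearMn /= mul_polyC linearZ /= umbralXn.
by rewrite -mulr_natl; ring.
Qed.

Section Uniqueness.
Variables (s : nat -> A) (P : nat -> {poly A}).
Hypothesis d0 : (0 < d)%N.
Hypothesis size_P : forall n, (size (P n) <= n.+1)%N.
Hypothesis P_dk : forall k, P (d * k) = (1 - 'X^d) ^+ k.
Hypothesis P_dk1 : forall k, P (d * k).+1 = (1 - 'X^d) ^+ k * (1 - 'X).
Hypothesis s_rec : forall n,
  \sum_(j < n) qint j.+1 t * (P n)`_j * s (n - j)%N = - (n%:R * qint n.+1 t * (P n)`_n).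

(** With n in place of s 0, the right-hand side of [s_rec] becomes the term j = n. *)
Lemma umbral_rec n :
  umbral (fun j => qint j.+1 t * (if (j < n)%N then s (n - j)%N else n%:R)) (P n) = 0.
Proof.
rewrite (umbral_wide _ (size_P n)) big_ord_recr /= ltnn.
rewrite (eq_bigr (fun j : 'I_n => qint j.+1 t * (P n)`_j * s (n - j)%N)).
  by rewrite s_rec; ring.
by move=> j _; rewrite ltn_ord; ring.
Qed.

Lemma s_dk_rec k :
  \sum_(i < k) (-1) ^+ i * 'C(k, i)%:R * qint (d * i).+1 t * s (d * (k - i))%N =
  - ((-1) ^+ k * (d * k)%:R * qint (d * k).+1 t).
Proof.
have := umbral_rec (d * k); rewrite P_dk umbral_binom_Xd big_ord_recr /= ltnn binn mulr1.
move/eqP; rewrite addr_eq0 => /eqP h.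
rewrite [RHS](_ : _ = - ((-1) ^+ k * (qint (d * k).+1 t * (d * k)%:R))); last ring.
rewrite -h; apply: eq_bigr => i _.
by rewrite ltn_pmul2l // ltn_ord mulnBr; ring.
Qed.

Lemma s_dk1_rec k :
  \sum_(i < k.+1) (-1) ^+ i * 'C(k, i)%:R * qint (d * i).+1 t * s (d * (k - i)).+1 -
  \sum_(i < k) (-1) ^+ i * 'C(k, i)%:R * qint (d * i).+2 t * s (d * (k - i))%N =
  (-1) ^+ k * (d * k).+1%:R * qint (d * k).+2 t.
Proof.
have := umbral_rec (d * k).+1; rewrite P_dk1 umbral_binom_Xd1.
rewrite [X in _ - X]big_ord_recr /= ltnn binn mulr1 opprD addrA.
move/eqP; rewrite subr_eq0 => /eqP h.
rewrite [RHS](_ : _ = (-1) ^+ k * (qint (d * k).+2 t * (d * k).+1%:R)); last ring.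
rewrite -h; congr (_ - _); apply: eq_bigr => i _.
  have hi : (d * i <= d * k)%N by rewrite leq_mul2l -ltnS ltn_ord orbT.
  by rewrite ltnS hi subSn // mulnBr; ring.
by rewrite ltnS ltn_pmul2l // ltn_ord subSS mulnBr; ring.
Qed.

(** Both families satisfy the same recurrences, where the term i = 0 has coefficient [1]_t = 1 and
    so is determined by the others. The value s 0 never occurs there, whence the guard k =
    [l.+1]. *)
Lemma s_values k : (forall l, k = l.+1 -> s (d * k)%N = val_dk k) /\ s (d * k).+1 = val_dk1 k.
Proof.
elim/ltn_ind: k => k IH.
have h0 l : k = l.+1 -> s (d * k)%N = val_dk k.
  move=> kl; have := s_dk_rec k; rewrite -val_dk_rec kl !big_ord_recl /= !subn0 muln0 qint1.
  rewrite bin0 expr0 !mul1r.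
  rewrite [X in _ + X = _ -> _](_ : _ = \sum_(i < l) (-1) ^+ bump 0 i * 'C(l.+1, bump 0 i)%:R *
     qint (d * bump 0 i).+1 t * val_dk (l.+1 - bump 0 i)); first exact: addIr.
  apply: eq_bigr => i _; rewrite /bump /= add1n subSS; congr (_ * _).
  have hi := ltn_ord i; have -> : (l - i = (l - i).-1.+1)%N by lia.
  by case: (IH (l - i).-1.+1) => [|h _]; [lia | exact: h].
split=> //; have := s_dk1_rec k; rewrite -val_dk1_rec.
rewrite (eq_bigr (fun i : 'I_k => (-1) ^+ i * 'C(k, i)%:R * qint (d * i).+2 t * val_dk (k - i))).
  move/addIr; rewrite !big_ord_recl /= !subn0 muln0 qint1 bin0 expr0 !mul1r.
  rewrite [X in _ + X = _ -> _](_ : _ = \sum_(i < k) (-1) ^+ bump 0 i * 'C(k, bump 0 i)%:R *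
     qint (d * bump 0 i).+1 t * val_dk1 (k - bump 0 i)); first exact: addIr.
  apply: eq_bigr => i _; congr (_ * _); rewrite /bump /= add1n.
  by case: (IH (k - i.+1)%N) => //; have := ltn_ord i; lia.
move=> i _; congr (_ * _); have hi := ltn_ord i.
(* The term i = 0 involves s (dk) itself, just settled by [h0]. *)
case: (posnP i) => [->|ipos]; first by rewrite subn0; apply: (h0 k.-1); lia.
have -> : (k - i = (k - i).-1.+1)%N by lia.
by case: (IH (k - i).-1.+1) => [|h _]; [lia | exact: h].
Qed.

End Uniqueness.

End Recurrence.

(** * Evaluation at a primitive root of unity *)

Section RootOfUnity.
Variables (C : fieldType) (d : nat) (w : C).
Hypothesis hw : d.-primitive_root w.

Lemma prod_prim_root : \prod_(i < d) (1 - (w ^+ i)%:P * 'X) = 1 - 'X^d.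
Proof.
have d0 := prim_order_gt0 hw.
have w0 i : w ^+ i != 0 by rewrite expf_neq0 // (prim_root_eq0 hw) -lt0n.
have hv : d.-primitive_root w^-1.
  have -> : w^-1 = w ^+ d.-1.
    by apply: (mulfI (w0 1%N)); rewrite mulfV ?(w0 1%N) // -exprS prednK // prim_expr_order.
  by rewrite prim_root_exp_coprime // coprimePn.
have e : \prod_(i < d) (1 - (w ^+ i)%:P * 'X) = (\prod_(i < d) - w ^+ i)%:P * ('X^d - 1).
  rewrite -(factor_Xn_sub_1 hv) big_mkord rmorph_prod -big_split /=.
  apply: eq_bigr => i _; rewrite mulrBr -rmorphM /= exprVn mulNr mulfV // !rmorphN /=.
  by rewrite polyC1; ring.
(* Evaluation at 0 determines the constant factor. *)
have := congr1 (fun p : {poly C} => p.[0]) e.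
rewrite horner_prod big1 => [|i _]; last by rewrite !hornerE ?mulr0 ?subr0.
rewrite hornerM hornerC hornerD hornerN hornerXn hornerC expr0n gtn_eqF //= sub0r mulrN1 => h.
rewrite e (canRL (@opprK _) (esym h)).
by rewrite rmorphN /= polyC1; ring.
Qed.

Lemma prod_prim_root_mul k :
  \prod_(i < d * k) (1 - (w ^+ i)%:P * 'X) = (1 - 'X^d) ^+ k.
Proof.
elim: k => [|k IH]; first by rewrite muln0 big_ord0.
rewrite mulnS big_split_ord /= prod_prim_root exprS -IH; congr (_ * _).
by apply: eq_bigr => i _; rewrite exprD (prim_expr_order hw) mul1r.
Qed.

(** The base ring is [{poly C}], with t = ['X]; hence q is evaluated at the constant polynomial
    w. *)
Lemma map_beta n : map_poly (horner_eval w%:P) (beta {poly C} n) =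
  map_poly polyC (\prod_(i < n) (1 - (w ^+ i)%:P * 'X)).
Proof.
rewrite /beta /esgn !rmorph_prod; apply: eq_bigr => i _.
rewrite !rmorphB !rmorph1 !rmorphM /= !map_polyX !map_polyC /=.
by rewrite /horner_eval hornerXn -rmorphXn.
Qed.

(** A divisor e > 1 of dk + 1 does not divide d, so 1 - q^d is among the factors, at l = d / e. *)
Lemma cofac_prim_root e m k : (1 < e)%N -> (e * m = (d * k).+1)%N -> (0 < k)%N ->
  (cofac {poly C} e m).[w%:P] = 0.
Proof.
move=> e1 em k0; have d0 := prim_order_gt0 hw.
have ed : ~~ (e %| d)%N.
  apply/negP => h; have : (e %| (d * k).+1)%N by rewrite -em dvdn_mulr.
  by rewrite -addn1 dvdn_addr ?dvdn_mulr // dvdn1 => /eqP; lia.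
have hl : (d %/ e < m)%N by rewrite ltn_divLR 1?mulnC ?em; nia.
have hj : ((d %% e).-1 < e.-1)%N.
  by have := @ltn_pmod d e; move: ed; rewrite /dvdn; lia.
rewrite /cofac horner_prod (bigD1 (Ordinal hl)) //= horner_prod (bigD1 (Ordinal hj)) //=.
rewrite prednK ?lt0n // mulnC -divn_eq hornerD hornerN hornerXn hornerC -rmorphXn /= (prim_expr_order hw).
by rewrite subrr !mul0r.
Qed.

End RootOfUnity.

(** Since maj = exd + exc, the powers of w from exc cancel against w^-1. *)
Lemma cyclepoly_root (C : fieldType) n (w : C) : w != 0 ->
  (cyclepoly n ('X : {poly C}) 1).[w%:P] =
  Acyc_maj_exc n.+1 (w%:P) (w^-1 *: 'X : {poly C}).
Proof.
move=> w0; rewrite /cyclepoly horner_sum; apply: eq_bigr => s _.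
rewrite !mul1n hornerCM hornerXn maj_exd exprD exprZn -mul_polyC.
rewrite [RHS](_ : _ = w%:P ^+ exd s * (w%:P ^+ exc s * (w^-1 ^+ exc s)%:P) * 'X^(exc s)).
  by rewrite -[w%:P ^+ exc s]rmorphXn -rmorphM /= -exprMn mulfV // expr1n polyC1 mulr1 mulrC.
by ring.
Qed.

(** Because t^d - 1 = (t - 1) [d]_t, this is [eulerian_binomial] times D^k. *)
Lemma eulerian_scaled (C : comNzRingType) d k :
  let T := ('X : {poly C}) ^+ d in let D := qint d 'X in
  \sum_(i < k.+1) 'C(k, i)%:R * (T - 1) ^+ i * (eulerian (k - i) 'X * D ^+ (k - i)) =
  'X * (eulerian k 'X * D ^+ k) + (1 - 'X) *+ (k == 0%N).
Proof.
move=> T D; have -> : T - 1 = ('X - 1) * D by rewrite /T subrX1.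
transitivity (D ^+ k * \sum_(i < k.+1) 'C(k, i)%:R * ('X - 1) ^+ i * eulerian (k - i) ('X : {poly C})).
  rewrite [RHS]big_distrr /=; apply: eq_bigr => i _.
  have -> : D ^+ k = D ^+ i * D ^+ (k - i) by rewrite -exprD subnKC // -ltnS.
  by rewrite exprMn; ring.
rewrite eulerian_binomial; case: k => [|k] /=; last by rewrite mulr0n; ring.
by rewrite expr0; ring.
Qed.

Lemma lreg_1subX (C : idomainType) : GRing.lreg (1 - 'X : {poly C}).
Proof.
apply/lregP; rewrite -opprB oppr_eq0 -polyC1.
by rewrite polyXsubC_eq0.
Qed.

Lemma wordpoly_root (C : fieldType) d k (w : C) : (0 < k)%N -> d.-primitive_root w ->
  (wordpoly ('X : {poly C}) (d * k).+1).[w%:P] =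
  (d * k).+1%:R * 'X * (eulerian k 'X * qint d 'X ^+ k).
Proof.
move=> k0 hw; have d0 := prim_order_gt0 hw.
pose P n := map_poly (horner_eval w%:P) (beta {poly C} n).
have t1 := @lreg_1subX C.
have a0 : eulerian 0 'X * qint d 'X ^+ 0 = 1 :> {poly C} by rewrite eulerian0 mulr1.
have sP n : (size (P n) <= n.+1)%N by apply: leq_trans (size_poly _ _) (size_beta _ n).
have P0 l : P (d * l)%N = (1 - 'X^d) ^+ l.
  by rewrite /P map_beta // prod_prim_root_mul // rmorphXn rmorphB rmorph1 /= map_polyXn.
have P1 l : P (d * l).+1 = (1 - 'X^d) ^+ l * (1 - 'X).
  rewrite /P map_beta // big_ord_recr /= prod_prim_root_mul //.
  rewrite exprM (prim_expr_order hw) expr1n polyC1 mul1r rmorphM rmorphXn !rmorphB !rmorph1 /=.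
  by rewrite map_polyXn map_polyX.
have t1' : GRing.lreg (1 - 'X%:P : {poly {poly C}}).
  by apply/lregP; rewrite -polyC1 -rmorphB polyC_eq0; apply/lregP.
have tE j : (qint j ('X%:P : {poly {poly C}})).[w%:P] = qint j 'X.
  by rewrite /qint horner_sum; apply: eq_bigr => i _; rewrite -rmorphXn hornerC.
have sr n : \sum_(j < n) qint j.+1 'X * (P n)`_j * (wordpoly ('X : {poly C}) (n - j)).[w%:P] =
    - (n%:R * qint n.+1 'X * (P n)`_n).
  have := congr1 (fun p => p.[w%:P]) (wordpoly_rec n t1').
  rewrite horner_sum hornerN !hornerM tE -polyC_natr hornerC /P coef_map => <-.
  by apply: eq_bigr => j _; rewrite !hornerM tE coef_map.
have [_ ->] := s_values t1 a0 (@eulerian_scaled C d)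
  (s := fun n => (wordpoly ('X : {poly C}) n).[w%:P]) d0 sP P0 P1 sr k.
by rewrite /val_dk1 gtn_eqF // addr0.
Qed.

(** Only the primitive words, of least period dk + 1, survive at w. *)
Lemma wordpoly_cyclepoly (C : fieldType) d k (w : C) : (0 < k)%N -> d.-primitive_root w ->
  (wordpoly ('X : {poly C}) (d * k).+1).[w%:P] = (cyclepoly (d * k) 'X 1).[w%:P] *+ (d * k).+1.
Proof.
move=> k0 hw; have d0 := prim_order_gt0 hw.
rewrite /wordpoly horner_sum (bigD1 ord_max) //= big1 ?addr0.
  rewrite hornerM divnn /= /cofac horner_prod big1 => [|l _]; last first.
    by rewrite big_ord0 hornerC.
  by rewrite mul1r /primpoly gtn_eqF ?muln_gt0 ?d0 // hornerMn.
move=> m /andP[mn hm]; rewrite hornerM (@cofac_prim_root _ d _ hw _ _ k) ?mul0r //.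
  have hlt : (m.+1 < (d * k).+1)%N.
    rewrite ltn_neqAle ltn_ord andbT; apply: contra hm => /eqP e.
    by apply/eqP/val_inj => /=; lia.
  by have := divnK mn; move: (_ %/ _)%N => e; nia.
by rewrite divnK.
Qed.

Theorem theorem6p3 (R : realType) (n d k : nat) (w : R[i])
    (hd : (0 < d)%N) (hk : (0 < k)%N) (hn : (d * k = n - 1)%N)
    (hw : d.-primitive_root w) :
  Acyc_maj_exc n (w%:P) (w^-1 *: 'X : {poly R[i]}) =
  'X * eulerian k ('X : {poly R[i]}) * qint d 'X ^+ k.
Proof.
have dk0 : (0 < d * k)%N by rewrite muln_gt0 hd.
have -> : n = (d * k).+1 by lia.
have w0 : w != 0 by rewrite (prim_root_eq0 hw) -lt0n.
rewrite -cyclepoly_root //.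
have := wordpoly_cyclepoly hk hw; rewrite (wordpoly_root hk hw) => h.
(* The common factor dk + 1 is cancelled coefficientwise, in characteristic 0. *)
apply/polyP => i; apply: (@mulfI _ (d * k).+1%:R); first by rewrite Num.Theory.pnatr_eq0.
rewrite !mulr_natl -!coefMn -h; congr ((polyseq _)`_i).
by rewrite -[RHS]mulr_natl !mulrA.
Qed.
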